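(* Let $t\ge 2$ and $r$ be integers with $2<r<2+t$. There exists a constant $k_0=k_0(t)$ such that the following hold for $k\ge k_0$. (1) If $G$ is an $n$-vertex graph with $\mathcal{N}(K_r,G)=kn^{3/2}$, then \[\mathcal{N}(K_{2,t},G)=\Omega\left(\min\left\{k^{\frac{t}{r-2}}n^{3/2},\ k^{\frac{2t^2}{(2t-1)(r-2)+t}}n^{\frac{(3t-2)(r-2)+2t}{(2t-1)(r-2)+t}}\right\}\right).\] (2) There exists an $n$-vertex graph $G$ with $\mathcal{N}(K_r,G)=\Omega(kn^{3/2})$ and \[\mathcal{N}(K_{2,t},G)= O\left(k^{\frac{2t^2}{(2t-1)(r-2)+t}}n^{\frac{(3t-2)(r-2)+2t}{(2t-1)(r-2)+t}}\right).\] (3) If there exists a bipartite graph $B$ with parts $U,V$ such that $|U|=k^{-2/(r-2)}n^{3/2}$, $|V|=n$, $e(B)=\Omega(k^{-1/(r-2)} n^{3/2})$, and every pair of vertices of $V$ is joined by fewer than $t$ paths of length at most 4 in $B$, then there exists an $n$-vertex graph $G$ with $\mathcal{N}(K_r,G)=\Omega(kn^{3/2})$ and \[\mathcal{N}(K_{2,t},G)= O\left(\min\left\{k^{\frac{t}{r-2}}n^{3/2},\ k^{\frac{2t^2}{(2t-1)(r-2)+t}}n^{\frac{(3t-2)(r-2)+2t}{(2t-1)(r-2)+t}}\right\}\right).\]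
   Context: For graphs $F,G$, $\mathcal{N}(F,G)$ is the number of subgraphs of $G$ isomorphic to $F$. $K_{2,t}$ is the complete bipartite graph with parts of sizes $2$ and $t$. $e(B)$ is the number of edges of $B$. Implicit constants in $\Omega,O$ may depend on $r$ and $t$ (and on the implicit constant in the hypothesis on $e(B)$), but not on $n$ or $k$.
   Formalization: Part (2) is stated for k with kn^{3/2} ≤ n^r; for larger k it fails as written, since an n-vertex graph has at most n^r copies of K_r (e.g. n = 1 and k tending to infinity). *)

(* Defs.v *)
From HB Require Import structures.
From mathcomp Require Import all_boot all_order all_algebra.
From mathcomp Require Import reals exp.

Set Implicit Arguments.
Unset Strict Implicit.
Unset Printing Implicit Defensive.

Import Order.TTheory GRing.Theory Num.Theory.

Local Open Scope ring_scope.

Record sgraph := SGraph {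
  vertex :> finType;
  adj : rel vertex;
  adj_sym : symmetric adj;
  adj_irr : irreflexive adj
}.

Definition edges (G : sgraph) : {set {set G}} :=
  [set [set p.1; p.2] | p in [pred p : G * G | adj p.1 p.2]].

(* A pair (W, E) of a vertex set and an edge set. *)
Definition is_subgraph (G : sgraph) (H : {set G} * {set {set G}}) : bool :=
  (H.2 \subset edges G) && [forall e in H.2, e \subset H.1].

Definition subgraph_iso (F G : sgraph) (H : {set G} * {set {set G}}) : bool :=
  [exists f : {ffun F -> G},
    [&& injectiveb f,
        H.1 == [set f x | x : F] &
        H.2 == [set [set f x | x in e] | e : {set F} in edges F]]].

(* Unlabelled, not necessarily induced, copies of F in G. *)
Definition ncopies (F G : sgraph) : nat :=
  #|[set H : {set G} * {set {set G}} | is_subgraph H & subgraph_iso F H]|.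

Section Complete.
Variables m n : nat.

Definition complete_adj : rel 'I_n := fun i j => i != j.

Lemma complete_adj_sym : symmetric complete_adj.
Proof. by move=> i j; rewrite /complete_adj eq_sym. Qed.

Lemma complete_adj_irr : irreflexive complete_adj.
Proof. by move=> i; rewrite /complete_adj eqxx. Qed.

Definition complete_graph : sgraph := SGraph complete_adj_sym complete_adj_irr.

Definition biclique_adj : rel ('I_m + 'I_n)%type :=
  fun x y => match x, y with
             | inl _, inr _ | inr _, inl _ => true
             | _, _ => false
             end.

Lemma biclique_adj_sym : symmetric biclique_adj.
Proof. by case=> [?|?] [?|?]. Qed.

Lemma biclique_adj_irr : irreflexive biclique_adj.
Proof. by case. Qed.

Definition complete_bipartite : sgraph :=
  SGraph biclique_adj_sym biclique_adj_irr.

End Complete.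

Definition bipartition (B : sgraph) (U V : {set B}) : bool :=
  [&& U :|: V == setT, [disjoint U & V] &
      [forall x, forall y, adj x y ==> ((x \in U) (+) (y \in U))]].

(* The tuple p lists the vertices of the path after its starting point x, so
   that its size is the number of edges. For x != y, each path joining x and y
   is counted once, being read from x to y. *)
Definition npaths_le (B : sgraph) (L : nat) (x y : B) : nat :=
  (\sum_(l < L.+1)
     #|[set p : l.-tuple B |
         [&& path (@adj B) x p, uniq (x :: p) & last x p == y]]|)%N.

Section Bounds.
Variables (R : realType) (r t n : nat) (k : R).

Definition bound1 : R := k `^ (t%:R / (r%:R - 2)) * n%:R `^ (3 / 2).

Definition bound2 : R :=
  let d := (2 * t%:R - 1) * (r%:R - 2) + t%:R in
  k `^ (2 * t%:R ^+ 2 / d)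
  * n%:R `^ (((3 * t%:R - 2) * (r%:R - 2) + 2 * t%:R) / d).

(* b is the implicit constant in the number of edges; the size prescribed for
   U, not an integer in general, is rounded down. *)
Definition few_paths_bigraph (b : R) (B : sgraph) (U V : {set B}) : Prop :=
  [/\ bipartition U V,
      #|U| = Num.truncn (k `^ (- 2 / (r%:R - 2)) * n%:R `^ (3 / 2)),
      #|V| = n,
      b * (k `^ (- 1 / (r%:R - 2)) * n%:R `^ (3 / 2)) <= #|edges B|%:R &
      {in V &, forall x y, x != y -> (npaths_le 4 x y < t)%N}].

End Bounds.

(* Main.v *)
(* Write s = r - 2 and d(x, y) for the codegree, so that labelled K_r's are at
   most the sum of d^s over adjacent pairs and labelled K_{2,t}'s are the sum of
   the falling factorial of d over all pairs.

   (1) Comparing d^s with the t-th falling factorial of d by a tangent at a level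
   l gives l^(t-s) N(K_r) = O(N(K_{2,t})) as soon as e(G) l^s is small against
   N(K_r). If e(G) = O(n^(3/2)), take l = k^(1/s); if e(G) is below the edge
   number M of the extremal example, take l to be the codegree of that example;
   otherwise supersaturation from the number of edges alone suffices.

   (2) Let V be a rows of g vertices each, and let G be the union of q cliques,
   each choosing one random vertex in every row. A K_{2,t} assigns its 2t edges
   to cliques; weighing each pattern by its probability, the dominant ones are
   "all edges in one clique" and "all edges in different cliques", and these
   balance for a, q chosen from the exponents of the theorem.

   (3) When the second bound is the smaller one, (2) applies. Otherwise cut the
   neighbourhoods of U into blocks of size about k^(1/s) and turn each block into
   a clique: the path condition bounds the codegree of any pair by O(k^(1/s)).
   If k^(1/s) is too small for this (bounded in terms of the constant in e(B)),
   an algebraic K_{2,t}-free graph with n^(3/2) copies of K_r does the job. *)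

Require Import Defs.
From mathcomp Require Import all_boot all_order all_algebra.
From mathcomp Require Import all_field.
From mathcomp Require Import reals exp.
From mathcomp Require Import zify ring lra.

Import Order.TTheory GRing.Theory Num.Theory.

Set Implicit Arguments.
Unset Strict Implicit.
Unset Printing Implicit Defensive.

(** * Labelled and unlabelled copies *)

Section Copies.
Variables F G : sgraph.

(** Labelled copies. All counting is done with them, since passing to [ncopies] costs only a
    constant factor. *)
Definition embeddings : {set {ffun F -> G}} :=
  [set f : {ffun F -> G} | injectiveb f & [forall x, forall y, adj x y ==> adj (f x) (f y)]].

Lemma embeddingP (f : {ffun F -> G}) :
  reflect (injective f /\ (forall x y : F, adj x y -> adj (f x) (f y)))
    (f \in embeddings).
Proof.
rewrite inE; apply: (iffP andP) => -[/injectiveP fi hom]; split=> //.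
  by move=> x y xy; have /forallP/(_ y)/implyP := forallP hom x; apply.
by apply/forallP=> x; apply/forallP=> y; apply/implyP/hom.
Qed.

Definition copy_of (f : {ffun F -> G}) : {set G} * {set {set G}} :=
  ([set f x | x : F], [set [set f x | x in e] | e : {set F} in edges F]).

Lemma edgesP (H : sgraph) (e : {set H}) :
  reflect (exists x y, adj x y /\ e = [set x; y]) (e \in edges H).
Proof.
apply: (iffP imsetP) => [[[x y]] | [x [y [xy ->]]]].
  by rewrite inE /= => xy ->; exists x, y.
by exists (x, y); rewrite ?inE.
Qed.

Lemma adj_neq (H : sgraph) (x y : H) : adj x y -> x != y.
Proof. by apply: contraTneq => ->; rewrite adj_irr. Qed.

Lemma set2_edges (H : sgraph) (x y : H) : ([set x; y] \in edges H) = adj x y.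
Proof.
apply/edgesP/idP => [[x' [y' [xy' e]]]|xy]; last by exists x, y.
have nxy := adj_neq xy'.
have xE : x \in [set x'; y'] by rewrite -e set21.
have yE : y \in [set x'; y'] by rewrite -e set22.
(* The set contains the distinct elements [x'] and [y'], so it is not a singleton. *)
have xy : x != y.
  apply: contraNneq nxy => exy.
  have : x' \in [set x; y] by rewrite e set21.
  have : y' \in [set x; y] by rewrite e set22.
  by rewrite !inE exy !orbb => /eqP-> /eqP->.
move: xE yE; rewrite !inE => /orP[]/eqP ex /orP[]/eqP ey; subst=> //.
- by rewrite eqxx in xy.
- by rewrite adj_sym.
- by rewrite eqxx in xy.
Qed.

(** Given that [f] parametrises the pair, [is_subgraph] amounts to [f] preserving adjacency. *)
Lemma copies_imset :
  [set H : {set G} * {set {set G}} | is_subgraph H & subgraph_iso F H]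
  = copy_of @: embeddings.
Proof.
apply/setP=> -[W E]; rewrite inE; apply/andP/imsetP.
  case=> /andP[/= sub _] /existsP[f /and3P[fi /eqP/= eW /eqP/= eE]].
  exists f; last by rewrite /copy_of -eW -eE.
  apply/embeddingP; split=> [|x y xy]; first exact/injectiveP.
  rewrite -set2_edges; apply: (subsetP sub); rewrite eE.
  apply/imsetP; exists [set x; y]; first by rewrite set2_edges.
  by rewrite imsetU !imset_set1.
case=> f /embeddingP[fi hom] [-> ->]; split.
  apply/andP; split=> /=.
    apply/subsetP=> _ /imsetP[_ /edgesP[x [y [xy ->]]] ->].
    by rewrite imsetU !imset_set1 set2_edges hom.
  apply/forallP=> e; apply/implyP=> /imsetP[e' _ ->].
  by apply/imsetS/subsetP.
by apply/existsP; exists f; rewrite !eqxx !andbT; apply/injectiveP.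
Qed.

Lemma ncopies_le_embeddings : (ncopies F G <= #|embeddings|)%N.
Proof. by rewrite /ncopies copies_imset leq_imset_card. Qed.

(** Embeddings with the same copy take values in the same set of [#|F|] vertices. This crude bound
    replaces the number of automorphisms. *)
Lemma embeddings_le_ncopies :
  (#|embeddings| <= ncopies F G * #|F| ^ #|F|)%N.
Proof.
rewrite /ncopies copies_imset -sum1_card (partition_big_imset copy_of) /=.
rewrite -sum_nat_const; apply: leq_sum => H /imsetP[f].
move=> /embeddingP[fi _] ->.
have -> : (#|F| ^ #|F| = #|@ffun_on_mem F G (mem [set f x | x : F])|)%N.
  by rewrite card_ffun_on card_imset.
rewrite sum1dep_card; apply: subset_leq_card; apply/subsetP => g.
rewrite inE => /andP[_ /eqP[eg _]].
by apply/ffun_onP=> x; rewrite -eg imset_f.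
Qed.

End Copies.

(** * Counting bicliques and cliques through codegrees *)

Section Codegree.
Variable G : sgraph.
Implicit Types x y : G.

Definition common_nbrs x y : {set G} := [set w | adj x w & adj y w].
Definition codeg x y : nat := #|common_nbrs x y|.
(** Ordered pairs, hence twice the number of edges. *)
Definition nadj : nat := \sum_(x : G) \sum_(y : G | adj x y) 1.

(** Once the part of size 2 is sent to [x], [y], the other part is any injection into their common
    neighbourhood; images of the two parts differ because adjacency is irreflexive. *)
Lemma card_biclique_embeddings t :
  #|embeddings (complete_bipartite 2 t) G|
  = (\sum_x \sum_(y | y != x) codeg x y ^_ t)%N.
Proof.
pose F := complete_bipartite 2 t.
pose a0 : F := inl ord0; pose a1 : F := inl (lift ord0 ord0).
pose embP := @embeddingP F G.
rewrite -sum1_card pair_big_dep /=.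
rewrite (partition_big (fun f : {ffun F -> G} => (f a0, f a1))
  (fun p : G * G => p.2 != p.1)) /=; last first.
  by move=> f fE; case/embP: fE => fi _; apply/eqP=> /fi.
apply: eq_bigr => -[x y] /= yx.
rewrite sum1dep_card.
pose ext (g : {ffun 'I_t -> G}) : {ffun F -> G} := [ffun v : F =>
  match v with inl i => if i == ord0 then x else y | inr j => g j end].
have ext_inj : injective ext.
  move=> g g' e; apply/ffunP => j.
  by move/ffunP/(_ (inr j)): e; rewrite !ffunE.
pose N := common_nbrs x y.
rewrite -[RHS](_ : #|[set g : {ffun 'I_t -> G} | g \in ffun_on N & injectiveb g]| = _);
  last first.
  rewrite /codeg -/N -[t in RHS]card_ord -card_inj_ffuns_on; apply: eq_card => g.
  by rewrite !inE.
rewrite -(card_imset _ ext_inj).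
apply: eq_card => f; rewrite [LHS]inE; apply/andP/imsetP.
  case=> /embP[fi homE] /eqP[f0 f1].
  exists [ffun j => f (inr j)].
    rewrite inE; apply/andP; split.
      apply/ffun_onP=> j; rewrite ffunE inE -f0 -f1.
      by rewrite !homE.
    by apply/injectiveP=> j j'; rewrite !ffunE => /fi[].
  apply/ffunP => -[i|j]; rewrite !ffunE //.
  case: (unliftP ord0 i) => [i'|] ->; last by rewrite eqxx -f0.
  by rewrite eq_sym (negbTE (neq_lift _ _)) -f1 /a1 (ord1 i').
case=> g; rewrite inE => /andP[/ffun_onP gN /injectiveP gi] ->.
have gA j : adj x (g j) && adj y (g j) by have := gN j; rewrite inE.
split; last by rewrite !ffunE eqxx.
apply/embP; split.
  move=> -[i|j] [i'|j']; rewrite !ffunE.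
  - case: (unliftP ord0 i) => [k|] ->; case: (unliftP ord0 i') => [k'|] -> //.
    + by rewrite (ord1 k) (ord1 k').
    + by rewrite eq_sym (negbTE (neq_lift _ _)) eqxx => e; rewrite e eqxx in yx.
    + by rewrite eqxx eq_sym (negbTE (neq_lift _ _)) => e; rewrite e eqxx in yx.
  - have /andP[/adj_neq/eqP h1 /adj_neq/eqP h2] := gA j'.
    by case: ifP.
  - have /andP[/adj_neq/eqP h1 /adj_neq/eqP h2] := gA j.
    by case: ifP => _ /esym.
  - by move/gi=> ->.
move=> -[i|j] [i'|j'] //= _; rewrite !ffunE.
- by have /andP[] := gA j'; case: ifP.
- by have /andP[] := gA j; rewrite [adj x _]adj_sym [adj y _]adj_sym; case: ifP.
Qed.

(** Fix the images of the first two vertices: the other [s] go to common neighbours, and their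
    mutual adjacency is forgotten. *)
Lemma clique_embeddings_le s :
  (#|embeddings (complete_graph s.+2) G|
   <= \sum_x \sum_(y | adj x y) codeg x y ^ s)%N.
Proof.
pose F := complete_graph s.+2.
pose a0 : F := ord0; pose a1 : F := lift ord0 ord0.
pose embP := @embeddingP F G.
rewrite -sum1_card pair_big_dep /=.
have homE (f : {ffun F -> G}) (u v : F) :
    f \in embeddings F G -> u != v -> adj (f u) (f v).
  by case/embP=> _ hom uv; apply: hom.
rewrite (partition_big (fun f : {ffun F -> G} => (f a0, f a1))
  (fun p : G * G => adj p.1 p.2)) /=; last first.
  by move=> f fE; apply: homE.
apply: leq_sum => -[x y] /= xy.
rewrite sum1dep_card.
pose res (f : {ffun F -> G}) : {ffun 'I_s -> G} :=
  [ffun j => f (lift ord0 (lift ord0 j))].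
pose N := common_nbrs x y.
have -> : (codeg x y ^ s = #|@ffun_on_mem 'I_s G (mem N)|)%N.
  by rewrite card_ffun_on card_ord.
rewrite -(card_in_imset (f := res)).
  apply: subset_leq_card; apply/subsetP => _ /imsetP[f + ->].
  rewrite inE => /andP[fE /eqP[f0 f1]].
  by apply/ffun_onP => j; rewrite ffunE inE -f0 -f1 !homE.
move=> f f'; rewrite !inE => /andP[_ /eqP[f0 f1]] /andP[_ /eqP[f0' f1']] e.
apply/ffunP=> i.
case: (unliftP ord0 i) => [j|] ->; last by rewrite -/a0 f0 f0'.
case: (unliftP ord0 j) => [k|] ->; last by rewrite -/a1 f1 f1'.
by move/ffunP/(_ k): e; rewrite !ffunE.
Qed.

(** Walks of two edges, counted by their ends and by their middle vertex. *)
Lemma sum_codeg :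
  (\sum_x \sum_y codeg x y = \sum_(w : G) #|[set x | adj w x]| ^ 2)%N.
Proof.
transitivity (\sum_(x : G) \sum_(y : G) \sum_(w | adj w x && adj w y) 1)%N.
  apply: eq_bigr => x _; apply: eq_bigr => y _; rewrite sum1dep_card.
  by apply: eq_card => w; rewrite !inE ![adj w _]adj_sym.
under eq_bigr => x _ do rewrite (exchange_big_dep predT) //=.
rewrite (exchange_big_dep predT) //=; apply: eq_bigr => w _.
rewrite -mulnn -[in RHS]sum1dep_card big_distrl /=.
rewrite [LHS]big_mkcond [RHS]big_mkcond /=; apply: eq_bigr => x _.
case: ifP => [wx|wx]; last by rewrite big_pred0 // => y; rewrite wx.
by rewrite mul1n sum1dep_card.
Qed.

Lemma nadjE : nadj = (\sum_(w : G) #|[set x | adj w x]|)%N.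
Proof. by apply: eq_bigr => w _; rewrite sum1dep_card. Qed.

Lemma sum_codeg_diag : (\sum_x codeg x x = nadj)%N.
Proof.
rewrite nadjE; apply: eq_bigr => x _; apply: eq_card => w.
by rewrite !inE andbb.
Qed.

End Codegree.

Local Open Scope ring_scope.

(** * Supersaturation from cliques and from edges *)

Section LowerBound.
Variable R : realType.

(** Each factor of the falling factorial is at least [d / 2]. *)
Lemma expn_le_ffact (t d : nat) : (2 * t <= d)%N -> (d ^ t <= 2 ^ t * d ^_ t)%N.
Proof.
elim: t => [|t IHt] td //; have {}IHt := IHt ltac:(lia).
rewrite ffactnSr !expnSr -mulnA [(2 * _)%N]mulnC !mulnA -mulnA.
by apply: leq_mul => //; lia.
Qed.

(* The tangent inequality replacing the convexity of [d -> d ^_ t]. *)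
Lemma tangent (t s d : nat) (l : R) : (s <= t)%N -> (2 * t)%:R <= l ->
  l ^+ (t - s) * d%:R ^+ s <= 2 ^+ t * (d ^_ t)%:R + l ^+ t.
Proof.
move=> st tl; have l0 : 0 <= l by apply: le_trans tl; rewrite ler0n.
have [ld|dl] := lerP l d%:R.
  have td : (2 * t <= d)%N by rewrite -(ler_nat R); apply: le_trans ld.
  apply: (@le_trans _ _ (2 ^+ t * (d ^_ t)%:R)); last by rewrite lerDl exprn_ge0.
  apply: (@le_trans _ _ (d%:R ^+ t)).
    by rewrite -[in X in _ <= X](subnK st) exprD ler_wpM2r ?exprn_ge0 // lerXn2r ?nnegrE.
  by rewrite -!natrX -natrM ler_nat expn_le_ffact.
apply: (@le_trans _ _ (l ^+ t)); last by rewrite lerDr mulr_ge0 ?exprn_ge0.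
rewrite -[in X in _ <= X](subnK st) exprD ler_wpM2l ?exprn_ge0 // lerXn2r ?nnegrE //.
exact: ltW.
Qed.

Variables (G : sgraph) (t : nat).
Let nK2t : R := #|embeddings (complete_bipartite 2 t) G|%:R.

Lemma sum_nadj (c : R) : \sum_(x : G) \sum_(y : G | adj x y) c = c * (nadj G)%:R.
Proof.
rewrite /nadj natr_sum mulr_sumr; apply: eq_bigr => x _.
by rewrite sum1_card sumr_const mulr_natr.
Qed.

(** Sum [tangent] over adjacent pairs. By hypothesis the error [l ^+ t * nadj G] is at most half of
    the left-hand side. *)
Lemma sparse_lower_bound (s : nat) (l : R) :
  (s <= t)%N -> (2 * t)%:R <= l ->
  let T := #|embeddings (complete_graph s.+2) G|%:R in
  2 * (l ^+ s * (nadj G)%:R) <= T -> l ^+ (t - s) * T <= 2 ^+ t.+1 * nK2t.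
Proof.
move=> st tl T hT; have l0 : 0 <= l by apply: le_trans tl; rewrite ler0n.
have h : l ^+ (t - s) * T <= 2 ^+ t * nK2t + l ^+ t * (nadj G)%:R.
  apply: (@le_trans _ _ (\sum_(x : G) \sum_(y : G | adj x y)
      (2 ^+ t * (codeg x y ^_ t)%:R + l ^+ t))).
    apply: (@le_trans _ _ (\sum_(x : G) \sum_(y : G | adj x y)
        l ^+ (t - s) * (codeg x y)%:R ^+ s)).
      under eq_bigr => x _ do rewrite -mulr_sumr.
      rewrite -mulr_sumr ler_wpM2l ?exprn_ge0 //.
      apply: (@le_trans _ _ (\sum_(x : G) \sum_(y : G | adj x y) codeg x y ^ s)%N%:R).
        by rewrite ler_nat clique_embeddings_le.
      rewrite natr_sum; apply: ler_sum => x _; rewrite natr_sum.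
      by apply: ler_sum => y _; rewrite natrX.
    by do 2!apply: ler_sum => ? _; apply: tangent.
  under eq_bigr => x _ do rewrite big_split /= -mulr_sumr.
  rewrite big_split /= -mulr_sumr sum_nadj lerD2r ler_wpM2l ?exprn_ge0 //.
  rewrite /nK2t card_biclique_embeddings natr_sum; apply: ler_sum => x _.
  rewrite natr_sum big_mkcond [leRHS]big_mkcond /=; apply: ler_sum => y _.
  case: ifP => xy; first by rewrite eq_sym (adj_neq xy).
  by case: ifP.
have : l ^+ t * (nadj G)%:R <= l ^+ (t - s) * T / 2.
  rewrite -[in leLHS](subnK st) exprD -!mulrA ler_wpM2l ?exprn_ge0 //; lra.
rewrite exprS; lra.
Qed.

(** Cauchy-Schwarz, from the nonnegativity of the variance. *)
Lemma sum_sqr_ge (I : finType) (d : I -> R) :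
  (\sum_i d i) ^+ 2 <= #|I|%:R * \sum_i d i ^+ 2.
Proof.
have [I0|I0] := posnP #|I|.
  by rewrite I0 mul0r big_pred0 ?expr0n // => i; have := card0_eq I0 i.
set S := \sum_i d i; have n0 : 0 < #|I|%:R :> R by rewrite ltr0n.
have : 0 <= \sum_i (d i - S / #|I|%:R) ^+ 2 by apply: sumr_ge0 => i _; rewrite sqr_ge0.
under eq_bigr => i _ do rewrite sqrrB.
rewrite big_split sumrB sumr_const sumrMnl -mulr_suml -/S /=.
set Q := \sum_i _; set N := #|I|%:R in n0 *.
have -> : Q - S * (S / N) *+ 2 + (S / N) ^+ 2 *+ #|I| = (N * Q - S ^+ 2) / N.
  by rewrite -mulr_natl -/N; field; rewrite gt_eqF.
by rewrite pmulr_lge0 ?invr_gt0 // subr_ge0.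
Qed.

(** Cauchy-Schwarz bounds the sum of codegrees over distinct pairs below by [m ^+ 2 / (2 * n)]. Then
    [tangent] with exponent 1 applies at the level [l], half of the resulting average, where the
    main term is twice the error. *)
Lemma dense_lower_bound :
  let n := #|G|%:R : R in let m := (nadj G)%:R : R in
  (0 < t)%N -> 0 < n -> 2 * n <= m -> (8 * t)%:R * n ^+ 3 <= m ^+ 2 ->
  (m ^+ 2 / (4 * n ^+ 3)) ^+ t * n ^+ 2 <= 2 ^+ t * nK2t.
Proof.
move=> n m t0 n0 nm tm; set l := m ^+ 2 / _.
have d0 : 0 < 4 * n ^+ 3 by rewrite mulr_gt0 // exprn_gt0.
have tl : (2 * t)%:R <= l.
  rewrite ler_pdivlMr // [leLHS](_ : _ = (8 * t)%:R * n ^+ 3) // !natrM; ring.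
have l0 : 0 <= l by apply: le_trans tl; rewrite ler0n.
have S : m ^+ 2 / (2 * n) <= \sum_(x : G) \sum_(y : G | y != x) (codeg x y)%:R.
  have -> : \sum_(x : G) \sum_(y : G | y != x) (codeg x y)%:R =
      (\sum_(w : G) #|[set x | adj w x]|%:R ^+ 2) - m.
    apply/eqP; rewrite -subr_eq opprK /m -sum_codeg_diag natr_sum -big_split /=.
    have -> : \sum_(w : G) #|[set x | adj w x]|%:R ^+ 2 =
        (\sum_(x : G) \sum_y codeg x y)%N%:R :> R.
      by rewrite sum_codeg natr_sum; apply: eq_bigr => w _; rewrite natrX.
    rewrite natr_sum; apply/eqP; apply: eq_bigr => x _.
    by rewrite natr_sum [in RHS](bigD1 x) //= addrC.
  have := sum_sqr_ge (fun w : G => #|[set x | adj w x]|%:R).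
  rewrite -natr_sum -nadjE -/m -/n; set Q := \sum_w _ => mQ.
  have mQ' : m ^+ 2 / n <= Q by rewrite ler_pdivrMr // mulrC.
  (* The diagonal contributes [m], at most half of [m ^+ 2 / n] because [2 * n <= m]. *)
  have -> : m ^+ 2 / (2 * n) = m ^+ 2 / n - m ^+ 2 / (2 * n).
    by field; rewrite gt_eqF.
  apply: lerB => //; rewrite ler_pdivlMr ?mulr_gt0 // expr2 ler_wpM2l //.
have h : l ^+ (t - 1) * (m ^+ 2 / (2 * n)) <= 2 ^+ t * nK2t + l ^+ t * n ^+ 2.
  apply: (@le_trans _ _ (\sum_(x : G) \sum_(y : G | y != x)
      (2 ^+ t * (codeg x y ^_ t)%:R + l ^+ t))).
    apply: (@le_trans _ _ (\sum_(x : G) \sum_(y : G | y != x)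
        l ^+ (t - 1) * (codeg x y)%:R ^+ 1)).
      under eq_bigr => x _ do rewrite -mulr_sumr.
      by rewrite -mulr_sumr ler_wpM2l ?exprn_ge0.
    by do 2!apply: ler_sum => ? _; apply: tangent.
  under eq_bigr => x _ do rewrite big_split /= -mulr_sumr.
  rewrite big_split /= -mulr_sumr lerD //.
    rewrite ler_wpM2l ?exprn_ge0 // /nK2t card_biclique_embeddings natr_sum.
    by apply: ler_sum => x _; rewrite natr_sum.
  apply: (@le_trans _ _ (\sum_(x : G) \sum_(y : G) l ^+ t)).
    by apply: ler_sum => x _; rewrite [leRHS](bigID (fun y => y != x)) /= lerDl
       sumr_ge0 // => y _; rewrite exprn_ge0.
  under eq_bigr => x _ do rewrite sumr_const.
  rewrite sumr_const -mulrnA -[leLHS]mulr_natr natrM -expr2.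
  exact: lexx.
have e : l ^+ (t - 1) * (m ^+ 2 / (2 * n)) = 2 * (l ^+ t * n ^+ 2).
  rewrite -[in RHS](subnK t0) exprD expr1; set P := l ^+ (t - 1).
  by rewrite /l; field; rewrite gt_eqF.
by move: h; rewrite e; lra.
Qed.

End LowerBound.

(** * Real powers as monomials in suitable roots *)

Section Monomials.
Variable R : realType.

Lemma powR_root (c e : R) (m j : nat) : 0 <= c -> (0 < m)%N ->
  e * m%:R = j%:R -> c `^ e = (c `^ m%:R^-1) ^+ j.
Proof.
move=> c0 m0 ej; rewrite -powR_mulrn ?powR_ge0 // -powRrM; congr (_ `^ _).
by rewrite -ej mulrC -mulrA divff ?mulr1 // pnatr_eq0 -lt0n.
Qed.

Lemma rootK (c : R) (m : nat) : 0 <= c -> (0 < m)%N -> c = (c `^ m%:R^-1) ^+ m.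
Proof. by move=> c0 m0; rewrite -(@powR_root c 1) ?mul1r ?powRr1. Qed.

Lemma root_ge1 (c : R) (m : nat) : 1 <= c -> 1 <= c `^ m%:R^-1.
Proof.
move=> c1; have := @ge0_ler_powR R m%:R^-1; rewrite invr_ge0 ler0n.
move=> /(_ isT 1 c); rewrite powR1; apply; rewrite ?nnegrE //.
exact: le_trans c1.
Qed.

(** The common denominator of the exponents of [bound2] for [r = s + 2]. *)
Definition den (t s : nat) : nat := ((2 * t - 1) * s + t)%N.

(** Here [x], [y], [z] are the roots of [k], [n], [k] of orders [den t s], [2 * den t s], [s]; the 2
    serves the exponent 3/2. All later comparisons then concern natural exponents. Only [y] can be
    less than 1, when [n = 0]. *)
Lemma bound_monomials (t s n : nat) (k : R) :
  (0 < t)%N -> (0 < s)%N -> 1 <= k ->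
  exists x y z : R,
  [/\ [/\ 1 <= x, 0 <= y, 1 <= z & (0 < n)%N -> 1 <= y],
      [/\ k = x ^+ den t s, k = z ^+ s, n%:R = y ^+ (2 * den t s) &
          n%:R `^ (3 / 2) = y ^+ (3 * den t s)],
      bound1 s.+2 t n k = z ^+ t * y ^+ (3 * den t s) &
      bound2 s.+2 t n k =
        x ^+ (2 * t ^ 2) * y ^+ (2 * ((3 * t - 2) * s + 2 * t))].
Proof.
move=> t0 s0 k1; have k0 : 0 <= k by apply: le_trans k1.
have d0 : (0 < den t s)%N by rewrite addn_gt0 t0 orbT.
have d20 : (0 < 2 * den t s)%N by rewrite muln_gt0.
have rs : s.+2%:R - 2 = s%:R :> R by rewrite -addn2 natrD addrK.
have ds : (2 * t%:R - 1) * s%:R + t%:R = (den t s)%:R :> R.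
  by rewrite natrD natrM natrB ?natrM //; lia.
have dR : (den t s)%:R != 0 :> R by rewrite pnatr_eq0 -lt0n.
have sR : s%:R != 0 :> R by rewrite pnatr_eq0 -lt0n.
have n32 : n%:R `^ (3 / 2) = (n%:R `^ (2 * den t s)%:R^-1) ^+ (3 * den t s) :> R.
  by apply: powR_root; rewrite // !natrM; field.
exists (k `^ (den t s)%:R^-1), (n%:R `^ (2 * den t s)%:R^-1), (k `^ s%:R^-1).
split.
- split; [exact: root_ge1|exact: powR_ge0|exact: root_ge1|].
  by move=> n0; apply: root_ge1; rewrite ler1n.
- by split; rewrite -?n32 // -rootK.
- by rewrite /bound1 rs -n32; congr (_ * _); apply: powR_root; rewrite ?divfK.
- rewrite /bound2 rs ds; congr (_ * _); apply: powR_root => //.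
    by rewrite divfK // natrM natrX.
  have e : ((3 * t - 2) * s + 2 * t)%:R = (3 * t%:R - 2) * s%:R + 2 * t%:R :> R.
    rewrite natrD natrM natrB; last lia.
    by rewrite !natrM.
  by rewrite [in LHS]natrM [in RHS]natrM e; field.
Qed.

End Monomials.

(* The extremal graphs have about [ecrit] edges, each lying in about [dcrit]
   triangles; here [x] and [y] are the roots of [k] and [n] that turn all the
   powers into monomials. *)
Definition dcrit (R : realType) (t : nat) (x y : R) : R := x ^+ (2 * t - 1) * y.
Definition ecrit (R : realType) (t s : nat) (x y : R) : R :=
  x ^+ t * y ^+ (3 * t + (6 * t - 4) * s).

(** * The lower bound of part (1) *)

Section LowerBoundMonomials.
Variable R : realType.
Implicit Types (x y : R) (t s : nat).

(** The right-hand side is [k n^(3/2)]: the extremal example has the required number of cliques. *)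
Lemma ecrit_clique t s x y : (0 < t)%N ->
  ecrit t s x y * dcrit t x y ^+ s = x ^+ den t s * y ^+ (3 * den t s).
Proof.
case: t => // t _; rewrite /ecrit /dcrit /den exprMn -exprM mulrACA -!exprD.
have -> : (2 * t.+1 - 1 = (2 * t).+1)%N by lia.
have -> : (6 * t.+1 - 4 = 6 * t + 2)%N by lia.
by congr (_ ^+ _ * _ ^+ _); lia.
Qed.

(** The right-hand side is the monomial form of [bound2]. *)
Lemma ecrit_biclique t s x y : (0 < t)%N ->
  ecrit t s x y * dcrit t x y ^+ t =
  x ^+ (2 * t ^ 2) * y ^+ (2 * ((3 * t - 2) * s + 2 * t)).
Proof.
case: t => // t _; rewrite /ecrit /dcrit exprMn -exprM mulrACA -!exprD -mulnn.
have -> : (2 * t.+1 - 1 = (2 * t).+1)%N by lia.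
have -> : (6 * t.+1 - 4 = 6 * t + 2)%N by lia.
have -> : (3 * t.+1 - 2 = 3 * t + 1)%N by lia.
by congr (_ ^+ _ * _ ^+ _); lia.
Qed.

(** With [M], [a] for [ecrit], [dcrit] this reads [M a^t = (M^2 / n^3)^t n^2]: the count forced by
    [M] edges alone agrees with that of the extremal example. *)
Lemma ecrit_dense t s x y : (0 < t)%N ->
  ecrit t s x y * dcrit t x y ^+ t * (y ^+ (2 * den t s)) ^+ (3 * t) =
  ecrit t s x y ^+ (2 * t) * (y ^+ (2 * den t s)) ^+ 2.
Proof.
case: t => // t _; rewrite ecrit_biclique // /ecrit /den exprMn -!exprM.
rewrite -!mulrA -!exprD -mulnn.
have -> : (2 * t.+1 - 1 = (2 * t).+1)%N by lia.
have -> : (6 * t.+1 - 4 = 6 * t + 2)%N by lia.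
have -> : (3 * t.+1 - 2 = 3 * t + 1)%N by lia.
by congr (_ ^+ _ * _ ^+ _); lia.
Qed.

(** If [x < A] then [x ^+ s < A ^+ s <= A ^+ t]. It turns a threshold on [k] that depends on [t]
    only into thresholds on its roots. *)
Lemma le_of_exprs (t s : nat) (A x : R) : (0 < s <= t)%N -> 0 <= x -> 1 <= A ->
  A ^+ t <= x ^+ s -> A <= x.
Proof.
case/andP=> s0 st x0 A1; apply: contraTT; rewrite -!ltNge => xA.
apply: (@lt_le_trans _ _ (A ^+ s)).
  by rewrite ltr_pXn2r // nnegrE ltW // (le_lt_trans x0).
exact: ler_weXn2l.
Qed.

(** Since [den t s <= (2 * t - 1) * s.+1], the previous lemma applies to [x ^+ (2 * t - 1)] with
    exponent [s.+1 <= t]. *)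
Lemma le_dcrit t s (A x y : R) : (0 < t)%N -> (s < t)%N -> 1 <= A -> 1 <= x -> 1 <= y ->
  A ^+ t <= x ^+ den t s -> A <= dcrit t x y.
Proof.
move=> t0 st A1 x1 y1 Ax; have x0 : 0 <= x by apply: le_trans x1.
have xx : A <= x ^+ (2 * t - 1).
  apply: (@le_of_exprs t s.+1); rewrite ?exprn_ge0 //.
  by apply: (le_trans Ax); rewrite -exprM ler_weXn2l // /den; nia.
by apply: (le_trans xx); rewrite /dcrit ler_peMr ?exprn_ge0.
Qed.

Lemma embeddings_card_le (F G : sgraph) :
  #|embeddings F G|%:R <= (#|F| ^ #|F|)%:R * (ncopies F G)%:R :> R.
Proof. by rewrite -natrM ler_nat mulnC embeddings_le_ncopies. Qed.

(** The three ranges of the number [m] of ordered edges: up to [4 * t * N3], up to [M], and beyond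
    both. The first yields the first bound, the others the second. *)
Lemma min_le_biclique_embeddings t s n x y z (G : sgraph) :
  let L := #|embeddings (complete_bipartite 2 t) G|%:R : R in
  (0 < s < t)%N -> (0 < n)%N -> #|G| = n -> 1 <= x -> 1 <= y -> 1 <= z ->
  n%:R = y ^+ (2 * den t s) -> x ^+ den t s = z ^+ s ->
  (16 * t ^ 2)%:R ^+ t <= z ^+ s ->
  z ^+ s * y ^+ (3 * den t s) <= #|embeddings (complete_graph s.+2) G|%:R ->
  Num.min (z ^+ t * y ^+ (3 * den t s))
    (x ^+ (2 * t ^ 2) * y ^+ (2 * ((3 * t - 2) * s + 2 * t)))
  <= (8 * t)%:R ^+ t * 2 ^+ t.+1 * L.
Proof.
move=> L /andP[s0 st].
have t0 : (0 < t)%N by lia.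
have t8 : (1 <= 8 * t)%N by lia.
have t8' : (2 <= 8 * t)%N by lia.
have t8'' : (4 <= 8 * t)%N by lia.
have t4 : (2 <= 4 * t)%N by lia.
have tA : (2 * t * (8 * t) <= 16 * t ^ 2)%N by lia.
have tA' : (2 * t * 2 <= 16 * t ^ 2)%N by nia.
have tB : (8 * t <= (4 * t) ^ 2)%N by nia.
have d23 : (2 * den t s <= 3 * den t s)%N by lia.
have d6 : (3 * den t s * 2 = 2 * den t s * 3)%N by lia.
move=> n0 Gn x1 y1 z1 ny xz Az TT.
have A1 : 1 <= (16 * t ^ 2)%:R :> R by rewrite ler1n muln_gt0 expn_gt0 t0.
have zA : (16 * t ^ 2)%:R <= z.
  by apply: (@le_of_exprs t s); rewrite ?s0 ?(ltnW st) // (le_trans _ z1).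
have aA : (16 * t ^ 2)%:R <= dcrit t x y by apply: (@le_dcrit t s); rewrite ?xz.
have z0 : 0 <= z by apply: le_trans z1.
have y0 : 0 <= y by apply: le_trans y1.
have x0 : 0 <= x by apply: le_trans x1.
have tR : 0 < (8 * t)%:R :> R by rewrite ltr0n.
have L0 : 0 <= L by rewrite ler0n.
rewrite -ecrit_biclique //.
set a := dcrit t x y in aA *; set M := ecrit t s x y.
have Ma : M * a ^+ s = z ^+ s * y ^+ (3 * den t s) by rewrite ecrit_clique // xz.
have a0 : 0 <= a by apply: le_trans aA; rewrite ler0n.
have M0 : 0 <= M by rewrite mulr_ge0 ?exprn_ge0.
set T := #|embeddings (complete_graph s.+2) G|%:R in TT.
set N3 := y ^+ (3 * den t s) in TT Ma *.
have N30 : 0 <= N3 by rewrite exprn_ge0.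
set m := (nadj G)%:R : R.
have t8R : 1 <= (8 * t)%:R :> R by rewrite ler1n.
rewrite ge_min; apply/orP.
have [m1|m1] := lerP m ((4 * t)%:R * N3).
  (* Level [k^(1/s)]; the divisor [8 * t] pays for the [4 * t] in [m1] and the 2 in
     [sparse_lower_bound]. *)
  left; pose l : R := z / (8 * t)%:R.
  have tl : (2 * t)%:R <= l.
    by rewrite ler_pdivlMr // -natrM; apply: le_trans zA; rewrite ler_nat.
  have := @sparse_lower_bound R G t s l (ltnW st) tl; rewrite -/T -/L -/m => sp.
  have {}sp : l ^+ (t - s) * T <= 2 ^+ t.+1 * L.
    apply: sp; apply: le_trans TT.
    apply: (@le_trans _ _ (2 * (l ^+ s * ((4 * t)%:R * N3)))).
      by rewrite ler_wpM2l // ler_wpM2l // exprn_ge0 // divr_ge0.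
    have -> : 2 * (l ^+ s * ((4 * t)%:R * N3)) = l ^+ s * (8 * t)%:R * N3.
      by rewrite !natrM; ring.
    rewrite ler_wpM2r // /l expr_div_n mulrAC ler_pdivrMr ?exprn_gt0 //.
    by rewrite ler_wpM2l ?exprn_ge0 // ler_eXnr.
  rewrite -mulrA; apply: (@le_trans _ _ ((8 * t)%:R ^+ t * (l ^+ (t - s) * T))); last first.
    by rewrite ler_wpM2l // exprn_ge0 // ltW.
  apply: (@le_trans _ _ ((8 * t)%:R ^+ t * (l ^+ (t - s) * (z ^+ s * N3)))); last first.
    by rewrite !ler_wpM2l // exprn_ge0 // ?divr_ge0 // ltW.
  rewrite !mulrA ler_wpM2r // /l expr_div_n -{1}(subnK (ltnW st)) exprD.
  rewrite ler_wpM2r ?exprn_ge0 // mulrA ler_pdivlMr ?exprn_gt0 //.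
  by rewrite mulrC ler_wpM2r ?exprn_ge0 // ler_weXn2l // leq_subr.
right.
have t2 : 2 ^+ t <= (8 * t)%:R ^+ t :> R.
  by rewrite lerXn2r ?nnegrE // ?(ltW tR) // ler_nat.
have [m2|m2] := lerP m M.
  (* The extremal codegree, halved to pay for the 2 in [sparse_lower_bound]. *)
  pose l : R := a / 2.
  have tl : (2 * t)%:R <= l.
    by rewrite ler_pdivlMr // -natrM; apply: le_trans aA; rewrite ler_nat.
  have := @sparse_lower_bound R G t s l (ltnW st) tl; rewrite -/T -/L -/m => sp.
  have {}sp : l ^+ (t - s) * T <= 2 ^+ t.+1 * L.
    apply: sp; apply: le_trans TT; rewrite -Ma.
    apply: (@le_trans _ _ (2 * (l ^+ s * M))).
      by rewrite ler_wpM2l // ler_wpM2l // exprn_ge0 // divr_ge0.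
    rewrite mulrA mulrC ler_wpM2l // /l expr_div_n mulrA ler_pdivrMr ?exprn_gt0 //.
    by rewrite mulrC ler_wpM2l ?exprn_ge0 // ler_eXnr // ler1n.
  rewrite -mulrA; apply: (@le_trans _ _ (2 ^+ t * (l ^+ (t - s) * T))); last first.
    by apply: ler_pM => //; rewrite ?mulr_ge0 ?exprn_ge0 ?divr_ge0 ?ler0n.
  apply: (@le_trans _ _ (2 ^+ t * (l ^+ (t - s) * (z ^+ s * N3)))); last first.
    by rewrite !ler_wpM2l // exprn_ge0 // ?divr_ge0 // ltW.
  rewrite -Ma -{1}(subnK (ltnW st)) exprD /l expr_div_n.
  have -> : 2 ^+ t * (a ^+ (t - s) / 2 ^+ (t - s) * (M * a ^+ s)) =
     2 ^+ t / 2 ^+ (t - s) * (M * (a ^+ (t - s) * a ^+ s)).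
    by set u := (2 ^+ (t - s))^-1; ring.
  rewrite ler_peMl ?mulr_ge0 ?exprn_ge0 // ler_pdivlMr ?exprn_gt0 // mul1r.
  by rewrite ler_weXn2l ?ler1n // leq_subr.
(* Dense case: [m1] supplies both density hypotheses of [dense_lower_bound], and [M < m] with
   [ecrit_dense] evaluates its conclusion. *)
have N3n : N3 ^+ 2 = n%:R ^+ 3 by rewrite ny /N3 -!exprM; congr (_ ^+ _).
have nR : 0 < n%:R :> R by rewrite ltr0n.
have mm : 0 <= m by rewrite ler0n.
have := @dense_lower_bound R G t; rewrite -/L -/m Gn => /(_ t0 nR) dn.
have {}dn : (m ^+ 2 / (4 * n%:R ^+ 3)) ^+ t * n%:R ^+ 2 <= 2 ^+ t * L.
  apply: dn.
    apply: le_trans (ltW m1); apply: ler_pM => //; first by rewrite ler_nat.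
    by rewrite ny /N3 ler_weXn2l.
  rewrite -N3n; apply: (@le_trans _ _ (((4 * t)%:R * N3) ^+ 2)).
    by rewrite exprMn ler_wpM2r ?exprn_ge0 // -natrX ler_nat.
  by rewrite lerXn2r ?nnegrE ?mulr_ge0 // ltW.
have Mn : (M ^+ 2 / (4 * n%:R ^+ 3)) ^+ t * n%:R ^+ 2 = M * a ^+ t / 4 ^+ t.
  have e := @ecrit_dense t s x y t0; rewrite -/M -/a -ny in e.
  have n3 : n%:R ^+ (3 * t) != 0 :> R by rewrite expf_neq0 // gt_eqF.
  have -> : M * a ^+ t = M ^+ (2 * t) * n%:R ^+ 2 / n%:R ^+ (3 * t) by rewrite -e mulfK.
  rewrite [(_ / _) ^+ t]expr_div_n [(4 * _) ^+ t]exprMn -[in LHS]exprM.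
  rewrite -[(n%:R ^+ 3) ^+ t]exprM invfM.
  by set u := (4 ^+ t)^-1; set v := (_ ^+ (3 * t))^-1; ring.
have {}dn : M * a ^+ t / 4 ^+ t <= 2 ^+ t * L.
  rewrite -Mn; apply: le_trans dn; rewrite ler_wpM2r ?exprn_ge0 //.
  rewrite lerXn2r ?nnegrE ?divr_ge0 ?mulr_ge0 ?exprn_ge0 // ler_wpM2r //.
    by rewrite invr_ge0 mulr_ge0 ?exprn_ge0.
  by rewrite lerXn2r ?nnegrE // ltW.
move: dn; rewrite ler_pdivrMr ?exprn_gt0 // => dn; apply: (le_trans dn).
rewrite mulrAC ler_wpM2r // mulrC; apply: ler_pM; rewrite ?exprn_ge0 //.
  by rewrite lerXn2r ?nnegrE // ?(ltW tR) // ler_nat.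
by rewrite exprS ler_peMl ?exprn_ge0 // ler1n.
Qed.

End LowerBoundMonomials.

Lemma supersaturation (R : realType) (t s : nat) : (0 < s < t)%N ->
  exists2 c : R, 0 < c &
  forall (n : nat) (k : R) (G : sgraph), (16 * t ^ 2)%:R ^+ t <= k -> #|G| = n ->
    (ncopies (complete_graph s.+2) G)%:R = k * n%:R `^ (3 / 2) ->
    c * Num.min (bound1 s.+2 t n k) (bound2 s.+2 t n k)
      <= (ncopies (complete_bipartite 2 t) G)%:R.
Proof.
case/andP=> s0 st; have t0 : (0 < t)%N by lia.
set F := complete_bipartite 2 t.
pose C : R := (8 * t)%:R ^+ t * 2 ^+ t.+1 * (#|F| ^ #|F|)%:R.
have C0 : 0 < C.
  rewrite !mulr_gt0 ?exprn_gt0 ?ltr0n ?expn_gt0 ?card_sum ?card_ord //; lia.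
exists C^-1; first by rewrite invr_gt0.
move=> n k G Ak Gn eT; rewrite ler_pdivrMl //.
have A1 : 1 <= (16 * t ^ 2)%:R :> R by rewrite ler1n; nia.
have k1 : 1 <= k by apply: le_trans Ak; rewrite exprn_ege1.
have [x [y [z [[x1 y0 z1 y1] [kx kz ny n3] -> ->]]]] := @bound_monomials R t s n k t0 s0 k1.
have [n0|n0] := posnP n.
  (* For [n = 0] the first bound vanishes, hence so does the claim. *)
  have n32 : (3 / 2 : R) != 0 by rewrite gt_eqF // divr_gt0.
  by rewrite ge_min -n3 n0 powR0 // mulr0 mulr_ge0 ?ler0n ?(ltW C0).
apply: (le_trans (@min_le_biclique_embeddings R t s n x y z G _ n0 Gn x1 (y1 n0) z1 ny _ _ _)).
- by rewrite s0.
- by rewrite -kx.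
- by rewrite -kz.
- by rewrite -kz -n3 -eT ler_nat ncopies_le_embeddings.
rewrite /C -!mulrA !ler_wpM2l ?exprn_ge0 //.
exact: embeddings_card_le.
Qed.

(** * An algebraic graph without [K_{2,t}] but with many cliques *)

Lemma field_with_functional (p h : nat) : prime p -> (0 < h)%N ->
  exists (F : finFieldType) (tau : F -> 'F_p),
  [/\ #|F| = (p ^ h)%N, {morph tau : x y / x + y} & exists e, tau e = 1].
Proof.
move=> p_pr h0.
have [F pF cF] := pPrimePowerField p_pr h0.
pose V := (pPrimeCharType pF : fieldExtType 'F_p).
have X : (0 < \dim {:V})%N by rewrite adim_gt0.
pose b := vbasis {:V}; pose i0 : 'I_(\dim {:V}) := Ordinal X.
(* The functional is the first coordinate in a basis over the prime field; the first basis vector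
   has value 1. *)
exists F, (fun x : F => coord b i0 (x : V)); split=> //.
  by move=> x y; rewrite -[RHS]linearD.
exists (tnth b i0 : V).
have fb : free b := basis_free (vbasisP {:V}).
by rewrite (tnth_nth 0) coord_free // eqxx.
Qed.

(* The vertex (i, x) is joined to (j, y) when det(x, y) = j - i; the condition
   tau = 1 on first coordinates removes the vectors that are parallel, which
   would share many neighbours. Points on an affine line P + i D with
   det(P, D) = 1 form the cliques. *)
Section DeterminantGraph.
Variables (p r : nat) (F : finFieldType) (tau : F -> 'F_p).
Hypotheses (p_pr : prime p) (rp : (r <= p)%N).
Hypothesis tauD : {morph tau : x y / x + y}.

Definition det2 (x y : F * F) : F := x.1 * y.2 - x.2 * y.1.

Definition det_adj : rel ('I_r * (F * F)) := fun u v =>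
  [&& u.1 != v.1, tau u.2.1 == 1, tau v.2.1 == 1 &
      det2 u.2 v.2 == v.1%:R - u.1%:R].

Lemma det2C x y : det2 x y = - det2 y x.
Proof. by rewrite /det2; ring. Qed.

Lemma det_adj_sym : symmetric det_adj.
Proof.
move=> u v; rewrite /det_adj eq_sym; congr (_ && _).
rewrite andbCA; congr [&& _, _ & _].
rewrite -[RHS]eqr_opp opprB; congr (_ == _); last by rewrite opprB.
by rewrite /det2; ring.
Qed.

Lemma det_adj_irr : irreflexive det_adj.
Proof. by move=> u; rewrite /det_adj eqxx. Qed.

Definition det_graph : sgraph := SGraph det_adj_sym det_adj_irr.

Lemma card_det_graph : #|det_graph| = (r * (#|F| * #|F|))%N.
Proof. by rewrite !card_prod card_ord. Qed.

Lemma tau0 : tau 0 = 0.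
Proof. by apply: (addrI (tau 0)); rewrite -tauD !addr0. Qed.

Lemma tauB x y : tau (x - y) = tau x - tau y.
Proof. by apply: (addIr (tau y)); rewrite -tauD !subrK. Qed.

Lemma tau_natl n x : tau (n%:R * x) = n%:R * tau x.
Proof.
elim: n => [|n IHn]; first by rewrite !mul0r tau0.
by rewrite -!natr1 !mulrDl !mul1r tauD IHn.
Qed.

(** This is where [r <= p] enters: row indices stay distinct modulo [p]. *)
Lemma Fp_ord_inj (i j : 'I_r) : i%:R = j%:R :> 'F_p -> i = j.
Proof.
move/(congr1 val); rewrite /= !val_Fp_nat // => e; apply: val_inj => /=.
by rewrite !modn_small ?(leq_trans (ltn_ord _)) in e.
Qed.

Lemma tau_ord_inj (x : F) (i j : 'I_r) : tau x = 1 -> i%:R * x = j%:R * x -> i = j.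
Proof. by move=> x1 /(congr1 tau); rewrite !tau_natl x1 !mulr1 => /Fp_ord_inj. Qed.

Lemma tau1_neq0 x : tau x = 1 -> x != 0.
Proof. by move=> x1; apply/eqP=> x0; move: x1; rewrite x0 tau0 => /eqP; rewrite eq_sym oner_eq0. Qed.

(** Cramer's rule. *)
Lemma det2_inj (x y w w' : F * F) : det2 x y != 0 ->
  det2 x w = det2 x w' -> det2 y w = det2 y w' -> w = w'.
Proof.
case: x y w w' => [x1 x2] [y1 y2] [w1 w2] [v1 v2]; rewrite /det2 /= => d ex ey.
have e1 : (x1 * y2 - x2 * y1) * (w1 - v1) = 0.
  have -> : (x1 * y2 - x2 * y1) * (w1 - v1) =
    y1 * ((x1 * w2 - x2 * w1) - (x1 * v2 - x2 * v1))
    - x1 * ((y1 * w2 - y2 * w1) - (y1 * v2 - y2 * v1)) by ring.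
  by rewrite ex ey !subrr !mulr0 subrr.
have e2 : (x1 * y2 - x2 * y1) * (w2 - v2) = 0.
  have -> : (x1 * y2 - x2 * y1) * (w2 - v2) =
    y2 * ((x1 * w2 - x2 * w1) - (x1 * v2 - x2 * v1))
    - x2 * ((y1 * w2 - y2 * w1) - (y1 * v2 - y2 * v1)) by ring.
  by rewrite ex ey !subrr !mulr0 subrr.
move/eqP: e1; move/eqP: e2; rewrite !mulf_eq0 (negbTE d) /= !subr_eq0.
by move=> /eqP-> /eqP->.
Qed.

(** If the vectors were dependent, eliminating [w] would give [(l - j) x1 = (l - i) y1]. Applying
    [tau] yields [i = j], then [x1 = y1], and finally [u = v]. *)
Lemma det_common (u v w : det_graph) : adj u w -> adj v w -> u != v ->
  det2 u.2 v.2 != 0.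
Proof.
case: u v w => [i [x1 x2]] [j [y1 y2]] [l [w1 w2]].
case/and4P=> /= il /eqP tx _ /eqP ex; case/and4P=> /= jl /eqP ty _ /eqP ey.
apply: contraNN => /eqP d0; rewrite /det2 /= in ex ey d0.
have e : (l%:R - j%:R) * x1 = (l%:R - i%:R) * y1.
  apply/eqP; rewrite -subr_eq0 -ex -ey.
  have -> : (y1 * w2 - y2 * w1) * x1 - (x1 * w2 - x2 * w1) * y1 =
     - w1 * (x1 * y2 - x2 * y1) by ring.
  by rewrite d0 mulr0.
have ij : i = j.
  apply: Fp_ord_inj; have := congr1 tau e.
  rewrite !mulrBl !tauB !tau_natl tx ty !mulr1 => /addrI/oppr_inj->//.
subst j; have li : l%:R - i%:R != 0 :> F.
  apply: contra_neq il => /eqP; rewrite subr_eq0 => /eqP eli.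
  by apply: (tau_ord_inj tx); rewrite eli.
have exy : x1 = y1 := mulfI li e.
rewrite exy in d0 *; have y0 := tau1_neq0 ty.
move/eqP: d0; rewrite [x2 * _]mulrC -mulrBr mulf_eq0 (negbTE y0) subr_eq0 /=.
by move/eqP->.
Qed.

Lemma det_common_inj (u v w w' : det_graph) : u != v ->
  adj u w -> adj v w -> adj u w' -> adj v w' -> w.1 = w'.1 -> w = w'.
Proof.
move=> uv uw vw uw' vw' e; have d := det_common uw vw uv.
case/and4P: uw => _ _ _ /eqP e1; case/and4P: vw => _ _ _ /eqP e2.
case/and4P: uw' => _ _ _ /eqP e3; case/and4P: vw' => _ _ _ /eqP e4.
have e5 : w.2 = w'.2 by apply: (det2_inj d); rewrite ?e1 ?e2 e ?e3 ?e4.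
by case: w w' e e5 {e1 e2 e3 e4} => [? ?] [? ?] /= -> ->.
Qed.

(** Independent [w], [w'] would determine the vectors of [u] and [v] by the same linear system. So
    they are parallel, and [tau] shows that they lie in the same row. *)
Lemma det_common_part (u v w w' : det_graph) : u != v -> u.1 = v.1 ->
  adj u w -> adj v w -> adj u w' -> adj v w' -> w = w'.
Proof.
move=> uv uv1 uw vw uw' vw'; apply: (det_common_inj uv uw) => //.
case: u v w w' uv uv1 uw vw uw' vw' => [i [x1 x2]] [j [y1 y2]] [l [w1 w2]] [m [v1 v2]].
move=> /= uv ij; subst j.
case/and4P=> /= il /eqP tx /eqP tw /eqP ex; case/and4P=> /= _ _ _ /eqP ey.
case/and4P=> /= im _ /eqP tv /eqP ex'; case/and4P=> /= _ _ _ /eqP ey'.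
have d0 : det2 (w1, w2) (v1, v2) = 0.
  apply: contraNeq uv => /det2_inj d0.
  have [-> ->//] : (x1, x2) = (y1, y2).
  by apply: d0; rewrite det2C [RHS]det2C ?ex ?ey ?ex' ?ey'.
apply: Fp_ord_inj.
have e : (m%:R - i%:R) * w1 = (l%:R - i%:R) * v1.
  apply/eqP; rewrite -subr_eq0 -ex -ex' /det2 /=.
  have -> : (x1 * v2 - x2 * v1) * w1 - (x1 * w2 - x2 * w1) * v1 =
     x1 * (w1 * v2 - w2 * v1) by ring.
  by move: d0; rewrite /det2 /= => ->; rewrite mulr0.
have := congr1 tau e.
by rewrite !mulrBl !tauB !tau_natl tw tv !mulr1 => /addIr.
Qed.

(** Vertices of one row have at most one common neighbour; vertices of two rows have at most one in
    each of the other [r - 2 <= t - 1] rows. *)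
Lemma codeg_det_graph (t : nat) (u v : det_graph) :
  (2 <= t)%N -> (r <= t.+1)%N -> u != v -> (codeg u v < t)%N.
Proof.
move=> t2 rt uv; have [e|n] := eqVneq u.1 v.1.
  apply: leq_trans t2; rewrite ltnS; apply/card_le1_eqP => w w'.
  rewrite !inE => /andP[uw vw] /andP[uw' vw'].
  exact: (det_common_part uv e).
rewrite /codeg -(card_in_imset (f := fun w : det_graph => w.1)); last first.
  move=> w w'; rewrite !inE => /andP[uw vw] /andP[uw' vw'].
  exact: (det_common_inj uv).
have -> : t = t.-1.+1 by lia.
rewrite ltnS; apply: (@leq_trans #|~: [set u.1; v.1]|).
  apply: subset_leq_card; apply/subsetP=> _ /imsetP[w + ->].
  rewrite !inE => /andP[/and4P[h _ _ _] /and4P[h' _ _ _]].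
  by rewrite negb_or ![w.1 == _]eq_sym h.
by rewrite cardsCs setCK cards2 n card_ord; lia.
Qed.

Lemma det_graph_K2t (t : nat) : (2 <= t)%N -> (r <= t.+1)%N ->
  #|embeddings (complete_bipartite 2 t) det_graph| = 0%N.
Proof.
move=> t2 rt; rewrite card_biclique_embeddings; apply: big1 => u _.
apply: big1 => v uv; rewrite ffact_small //.
by apply: codeg_det_graph; rewrite // eq_sym.
Qed.

(** Each of the [p] fibres is translated into the fibre over [c] by a multiple of [e]. *)
Lemma card_tau_fiber (c : 'F_p) : (exists e, tau e = 1) ->
  (#|F| <= p * #|[set x | tau x == c]|)%N.
Proof.
case=> e e1; have -> : #|F| = (\sum_(a : 'F_p) #|[set x | tau x == a]|)%N.
  rewrite -sum1_card (partition_big tau predT) //=.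
  by apply: eq_bigr => a _; rewrite sum1dep_card.
rewrite -[X in (_ <= X * _)%N](card_Fp p_pr) -sum_nat_const; apply: leq_sum => a _.
pose b : F := (nat_of_ord (c - a)%R)%:R * e.
have tb : tau b = c - a by rewrite tau_natl e1 mulr1 natr_Zp.
rewrite -(card_imset _ (addIr b)); apply: subset_leq_card.
apply/subsetP=> _ /imsetP[x + ->]; rewrite !inE => /eqP tx.
by rewrite tauD tx tb addrC subrK.
Qed.

(** The parameters are [P1], [d1], [P2] with [tau P1 = 1] and [tau d1 = 0]. On the line [P + i D]
    the determinant of the points [i] and [j] is [(j - i) det(P, D)]. *)
Lemma det_graph_cliques : (1 < r)%N -> (exists e, tau e = 1) ->
  (#|F| ^ 3 <= p ^ 2 * #|embeddings (complete_graph r) det_graph|)%N.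
Proof.
move=> r1 e1; pose S := setX (setX [set x | tau x == 1] [set x | tau x == 0]) [set: F].
have lS : (#|F| ^ 3 <= p ^ 2 * #|S|)%N.
  rewrite !cardsX cardsT !expnS !expn0 !muln1.
  have h1 := card_tau_fiber 1 e1; have h0 := card_tau_fiber 0 e1.
  have h := leq_mul h1 h0.
  rewrite [X in (_ <= X)%N](_ : _ = #|F| * (p * #|[set x | tau x == 1%R]| * (p * #|[set x | tau x == 0%R]|)))%N; last first.
    move: #|[set x | tau x == 1]| #|[set x | tau x == 0]| #|F| => A B C.
    by ring.
  by rewrite leq_mul2l h orbT.
apply: (leq_trans lS); rewrite leq_mul2l; apply/orP; right.
(* The solution of [P1 * d2 - P2 * d1 = 1]. *)
pose d2 (a : F * F * F) := (1 + a.2 * a.1.2) / a.1.1.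
pose f (a : F * F * F) : {ffun complete_graph r -> det_graph} :=
  [ffun i : 'I_r => (i, (a.1.1 + i%:R * a.1.2, a.2 + i%:R * d2 a))].
rewrite -(card_in_imset (f := f)).
  apply: subset_leq_card; apply/subsetP => _ /imsetP[[[P1 d1] P2] aS ->].
  apply/embeddingP; move: aS; rewrite !inE /= andbT => /andP[/eqP tP /eqP td].
  split=> [i j|i j ij]; rewrite !ffunE; first by case.
  have P0 := tau1_neq0 tP.
  apply/and4P; split=> //=; rewrite ?tauD ?tau_natl ?tP ?td ?mulr0 ?addr0 //.
  rewrite /det2 /d2 /=; apply/eqP; field; exact: P0.
move=> [[P1 d1] P2] [[P1' d1'] P2']; rewrite !inE /= => _ _ /ffunP ef.
have r0 : (0 < r)%N by apply: ltnW.
have := ef (Ordinal r0); rewrite !ffunE /= !mul0r !addr0 => -[eP1 eP2].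
by have := ef (Ordinal r1); rewrite !ffunE /= !mul1r => -[e _]; rewrite eP1 eP2 in e *; rewrite (addrI _ e).
Qed.

End DeterminantGraph.

(** * Isolated vertices, added to reach exactly [n] vertices *)

Section Padding.
Variables (G : sgraph) (m : nat).

Definition pad_adj : rel (G + 'I_m)%type := fun u v =>
  match u, v with inl x, inl y => adj x y | _, _ => false end.

Lemma pad_adj_sym : symmetric pad_adj.
Proof. by move=> [x|i] [y|j] //=; apply: adj_sym. Qed.

Lemma pad_adj_irr : irreflexive pad_adj.
Proof. by move=> [x|i] //=; apply: adj_irr. Qed.

Definition pad : sgraph := SGraph pad_adj_sym pad_adj_irr.

Lemma card_pad : #|pad| = (#|G| + m)%N.
Proof. by rewrite card_sum card_ord. Qed.

Lemma embeddings_pad (F : sgraph) : (#|embeddings F G| <= #|embeddings F pad|)%N.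
Proof.
pose f (h : {ffun F -> G}) : {ffun F -> pad} := [ffun v => inl (h v)].
rewrite -(card_in_imset (f := f)).
  apply: subset_leq_card; apply/subsetP=> _ /imsetP[h /embeddingP[hi hom] ->].
  apply/embeddingP; split=> [x y|x y xy]; rewrite !ffunE; last exact: hom.
  by case=> /hi.
move=> h h' _ _ /ffunP e; apply/ffunP=> v.
by have := e v; rewrite !ffunE => -[].
Qed.

Lemma codeg_pad (x y : G) : codeg (inl x : pad) (inl y) = codeg x y.
Proof.
rewrite /codeg -(card_imset (common_nbrs x y) (inl_inj (B := 'I_m))).
apply: eq_card => -[w|i]; rewrite !inE /=.
  by rewrite mem_imset ?inE //; apply: inl_inj.
by apply/esym/imsetP => -[].
Qed.

(** A pair with an isolated vertex has codegree 0, and [0 ^_ t = 0] for positive [t]. *)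
Lemma biclique_embeddings_pad t : (0 < t)%N ->
  #|embeddings (complete_bipartite 2 t) pad|
  = #|embeddings (complete_bipartite 2 t) G|.
Proof.
move=> t0; rewrite !card_biclique_embeddings big_sumType /=.
have no (u v : pad) i : u = inr i \/ v = inr i -> (codeg u v ^_ t = 0)%N.
  move=> uv; rewrite [codeg _ _](_ : _ = 0%N) ?ffact_small //.
  apply/eqP; rewrite cards_eq0; apply/eqP/setP=> w; rewrite !inE.
  by case: uv => ->; rewrite //= andbF.
rewrite [X in (_ + X)%N]big1 ?addn0; last first.
  by move=> i _; apply: big1 => v _; apply: (no _ _ i); left.
apply: eq_bigr => x _; rewrite big_sumType /=.
rewrite [X in (_ + X)%N]big1 ?addn0; last first.
  by move=> i _; apply: (no _ _ i); right.
by apply: eq_bigr => y _; rewrite codeg_pad.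
Qed.

End Padding.

Lemma exists_pad (G : sgraph) (n : nat) : (#|G| <= n)%N ->
  exists G' : sgraph, [/\ #|G'| = n,
    forall F, (#|embeddings F G| <= #|embeddings F G'|)%N &
    forall t, (0 < t)%N ->
      #|embeddings (complete_bipartite 2 t) G'|
      = #|embeddings (complete_bipartite 2 t) G|].
Proof.
move=> Gn; exists (pad G (n - #|G|)); split; first by rewrite card_pad subnKC.
  by move=> F; apply: embeddings_pad.
by move=> t; apply: biclique_embeddings_pad.
Qed.

Section ManyCliquesNoBiclique.
Variable R : realType.

Lemma many_cliques_no_biclique (p r t n : nat) : prime p -> (1 < r)%N -> (r <= p)%N ->
  (2 <= t)%N -> (r <= t.+1)%N -> (r * p ^ 2 <= n)%N ->
  exists G : sgraph, [/\ #|G| = n,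
    n%:R `^ (3 / 2)
      <= (p ^ 2 * (r * p ^ 2) ^ 2)%:R * #|embeddings (complete_graph r) G|%:R :> R &
    #|embeddings (complete_bipartite 2 t) G| = 0%N].
Proof.
move=> p_pr r1 rp t2 rt rn; have p1 := prime_gt1 p_pr.
have r0 : (0 < r)%N by lia.
(* The largest field whose graph fits into [n] vertices; by maximality it is too small only by a
   constant factor. *)
have [h [h0 hn nh]] : exists h, [/\ (0 < h)%N, (r * (p ^ h) ^ 2 <= n)%N &
    (n <= r * p ^ 2 * (p ^ h) ^ 2)%N].
  have ex : exists h, (r * (p ^ h) ^ 2 <= n)%N by exists 1%N; rewrite expn1.
  have bd h : (r * (p ^ h) ^ 2 <= n)%N -> (h <= n)%N.
    move=> hn; apply: leq_trans (ltnW (ltn_expl h p1)) _; apply: leq_trans hn.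
    by rewrite -mulnn mulnA leq_pmull // muln_gt0 r0 expn_gt0 ltnW.
  case: (ex_maxnP ex bd) => h hn hmax; exists h; split=> //.
    by apply: hmax; rewrite expn1.
  rewrite leqNgt; apply/negP=> hlt.
  suff : (h.+1 <= h)%N by rewrite ltnn.
  apply: hmax; rewrite (expnSr p h) expnMn; apply: leq_trans (ltnW hlt).
  by rewrite mulnAC -mulnA.
have [F [tau [cF tauD e1]]] := field_with_functional p_pr h0.
have [|G [Gn cl bi]] := @exists_pad (det_graph r tau) n.
  by rewrite card_det_graph cF mulnn.
exists G; split=> //; last by rewrite bi ?(det_graph_K2t p_pr rp) // ltnW.
have := leq_trans (det_graph_cliques p_pr tauD r1 e1) (leq_mul (leqnn _) (cl _)).
rewrite cF -(ler_nat R) natrM => qG.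
pose W := (r * p ^ 2)%N; pose q := (p ^ h)%N.
have W1 : 1 <= W%:R :> R by rewrite ler1n muln_gt0 r0 expn_gt0 ltnW.
apply: (@le_trans _ _ (W%:R ^+ 2 * q%:R ^+ 3)); last first.
  have -> : (p ^ 2 * W ^ 2)%:R = W%:R ^+ 2 * (p ^ 2)%:R :> R.
    by rewrite natrM mulrC natrX.
  by rewrite -[leRHS]mulrA ler_wpM2l ?exprn_ge0 ?ler0n // -natrX.
apply: (@le_trans _ _ ((W%:R * q%:R ^+ 2) `^ (3 / 2))).
  have := @ge0_ler_powR R (3 / 2); rewrite divr_ge0 // => /(_ isT n%:R (W%:R * q%:R ^+ 2)).
  apply; rewrite ?nnegrE ?mulr_ge0 ?exprn_ge0 ?ler0n //.
  by rewrite -natrX -natrM ler_nat.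
rewrite powRM ?exprn_ge0 ?ler0n //; apply: ler_pM; rewrite ?powR_ge0 //.
  rewrite -powR_mulrn ?ler0n //; apply: ler_powR => //.
  by rewrite ler_pdivrMr // -natrM ler_nat.
rewrite -!powR_mulrn ?ler0n // -powRrM.
by have -> : 2 * (3 / 2) = 3 :> R by field.
Qed.

End ManyCliquesNoBiclique.

Lemma ffact_le_expn (n m : nat) : (n ^_ m <= n ^ m)%N.
Proof.
elim: m => // m IHm; rewrite ffactnSr expnSr leq_mul //; exact: leq_subr.
Qed.

(** * Unions of cliques on prescribed blocks *)

Section BlockGraph.
Local Open Scope nat_scope.
Variables (V I : finType) (N : I -> {set V}) (a t : nat).

Definition block_adj : rel V := fun x y =>
  (x != y) && [exists i, (x \in N i) && (y \in N i)].

Lemma block_adj_sym : symmetric block_adj.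
Proof.
move=> x y; rewrite /block_adj eq_sym; congr (_ && _).
by apply: eq_existsb => i; rewrite andbC.
Qed.

Lemma block_adj_irr : irreflexive block_adj.
Proof. by move=> x; rewrite /block_adj eqxx. Qed.

Definition block_graph : sgraph := SGraph block_adj_sym block_adj_irr.

Hypothesis Na : forall i, #|N i| = a.
Hypothesis few_blocks : forall x y : V, x != y ->
  #|[set i | (x \in N i) && (y \in N i)]| < t.
Hypothesis few_detours : forall x y : V, x != y ->
  #|[set w : block_graph | [&& adj (x : block_graph) w, adj (y : block_graph) w &
      ~~ [exists i, [&& x \in N i, w \in N i & y \in N i]]]]| < t.

(** A common neighbour either shares a block with both [x] and [y], or reaches them only through
    different blocks and is one of the fewer than [t] detours. *)
Lemma codeg_block_le (x y : block_graph) : x != y ->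
  codeg x y < t + a * #|[set i | (x \in N i) && (y \in N i)]|.
Proof.
move=> xy; pose A := [set w : block_graph | [exists i, [&& x \in N i, w \in N i & y \in N i]]].
rewrite /codeg -(cardsID (~: A)) -addSn; apply: leq_add.
  apply: leq_ltn_trans (few_detours xy); apply: subset_leq_card.
  by apply/subsetP => w; rewrite !inE andbA.
set J := [set i | _].
have -> : a * #|J| = \sum_(i in J) #|N i|.
  by rewrite mulnC -sum_nat_const; apply: eq_bigr => i _; rewrite Na.
apply: (@leq_trans #|\bigcup_(i in J) N i|); last first.
  elim/big_rec2: _ => [|i n B _ IH]; first by rewrite cards0.
  by apply: leq_trans (leq_card_setU _ _) _; rewrite leq_add2l.
apply: subset_leq_card; apply/subsetP => w; rewrite !inE negbK.
case/andP=> /existsP[i /and3P[xi wi yi]] _.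
by apply/bigcupP; exists i; rewrite ?inE ?xi.
Qed.

(** Only pairs of codegree at least [t] contribute. Such a pair has a common block, so its codegree
    is at most [2 * t * a] and a factor [inc x y] may be inserted; [inc] sums to [#|I| * a ^ 2]. *)
Lemma block_biclique_embeddings_le : 0 < a ->
  #|embeddings (complete_bipartite 2 t) block_graph|
  <= #|I| * a ^ 2 * (2 * t * a) ^ t.
Proof.
move=> a0; rewrite card_biclique_embeddings.
pose inc (x y : V) := #|[set i | (x \in N i) && (y \in N i)]|.
apply: (@leq_trans (\sum_(x : V) \sum_(y : V) inc x y * (2 * t * a) ^ t)); last first.
  under eq_bigr => x _ do rewrite -big_distrl.
  rewrite -big_distrl /= leq_mul2r; apply/orP; right.
  rewrite /inc; under eq_bigr => x _ do
    (under eq_bigr => y _ do rewrite -sum1dep_card; rewrite (exchange_big_dep predT) //=).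
  rewrite (exchange_big_dep predT) //= -sum_nat_const; apply: leq_sum => i _.
  rewrite -mulnn -{1}(Na i) -sum_nat_const [X in _ <= X]big_mkcond /=.
  apply: leq_sum => x _; case: ifP => xi.
    rewrite -(Na i) -sum1_card big_mkcond [X in _ <= X]big_mkcond.
    by [].
  by rewrite big_pred0.
apply: leq_sum => x _; rewrite [X in _ <= X](bigID (fun y => y != x)) /=.
apply: leq_trans (leq_addr _ _); apply: leq_sum => y; rewrite eq_sym => xy.
have [lt|ge] := ltnP (codeg (x : block_graph) y) t; first by rewrite ffact_small.
have := codeg_block_le xy; rewrite -/(inc x y) => cle.
have inc0 : 0 < inc x y.
  by rewrite lt0n; apply/eqP => e; move: cle; rewrite e muln0 addn0 ltnNge ge.
apply: (@leq_trans (codeg (x : block_graph) y ^ t)).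
  exact: ffact_le_expn.
have := few_blocks xy; rewrite -/(inc x y) => ilt.
apply: leq_trans (leq_pmull _ inc0); rewrite leq_exp2r; last exact: leq_ltn_trans ilt.
apply: leq_trans (ltnW cle) _; nia.
Qed.

(** Each block contains [a ^_ r] labelled cliques, and each of these lies in fewer than [t] blocks
    because its first two vertices do. *)
Lemma block_clique_embeddings_ge (r : nat) : 1 < r ->
  #|I| * a ^_ r <= t * #|embeddings (complete_graph r) block_graph|.
Proof.
move=> r1; pose F := complete_graph r.
pose S i := [set f : {ffun 'I_r -> V} | (f \in ffun_on (N i)) && injectiveb f].
have -> : #|I| * a ^_ r = \sum_(i : I) #|S i|.
  rewrite -sum_nat_const; apply: eq_bigr => i _.
  rewrite -(Na i) -[r in LHS]card_ord -card_inj_ffuns_on; apply: eq_card => f.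
  by rewrite !inE.
rewrite mulnC -sum_nat_const.
under eq_bigr => i _ do rewrite -sum1_card.
rewrite (exchange_big_dep (fun f => f \in embeddings F block_graph)) /=; last first.
  move=> i f _; rewrite inE => /andP[/ffun_onP fN /injectiveP fi].
  apply/(@embeddingP F block_graph f); split=> // x y xy; apply/andP; split.
    by apply: contraNneq xy => /fi ->.
  by apply/existsP; exists i; rewrite !fN.
apply: leq_sum => f /(@embeddingP F block_graph f)[fi _]; rewrite sum1dep_card.
pose i0 : 'I_r := Ordinal (ltnW r1); pose i1 : 'I_r := Ordinal r1.
have n01 : f i0 != f i1 by apply/eqP => /fi.
apply: leq_trans (ltnW (few_blocks n01)); apply: subset_leq_card.
by apply/subsetP => i; rewrite !inE => /andP[/ffun_onP fN _]; rewrite !fN.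
Qed.

End BlockGraph.

(** * Cutting sets into blocks of equal size *)

Section Blocks.
Local Open Scope nat_scope.

Lemma exists_subset_card (T : finType) (A : {set T}) (m : nat) : m <= #|A| ->
  exists2 S : {set T}, S \subset A & #|S| = m.
Proof.
move=> mA; exists [set x in take m (enum A)].
  by apply/subsetP => x; rewrite inE => /mem_take; rewrite mem_enum.
rewrite cardsE (card_uniqP _) ?take_uniq ?enum_uniq // size_take -cardE.
by case: ltngtP mA.
Qed.

(** Greedy removal; the successor in the last clause accounts for a remainder of fewer than [a]
    elements. *)
Lemma exists_chunks (T : finType) (a : nat) (A : {set T}) : 0 < a ->
  exists P : {set {set T}},
  [/\ forall S, S \in P -> S \subset A /\ #|S| = a,
      forall S S' x, S \in P -> S' \in P -> x \in S -> x \in S' -> S = S' &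
      #|A| <= a * #|P|.+1].
Proof.
move=> a0; move: {2}#|A|.+1 (ltnSn #|A|) => m; elim: m A => // m IHm A Am.
have [Aa|aA] := ltnP #|A| a.
  exists set0; split=> [S|S S' x|]; rewrite ?inE //.
  by rewrite cards0 muln1 ltnW.
have [S SA Sa] := exists_subset_card aA.
have cD : #|A :\: S| = #|A| - a by rewrite cardsD (setIidPr SA) Sa.
have [|P [PA Pd Pc]] := IHm (A :\: S); first by rewrite cD; lia.
have nSP : S \notin P.
  apply/negP => /PA[/subsetP SD _].
  have /set0Pn[x xS] : S != set0 by rewrite -card_gt0 Sa.
  by have := SD x xS; rewrite inE xS.
have dS S' x : S' \in P -> x \in S -> x \in S' -> False.
  by move=> /PA[/subsetP SD _] xS /SD; rewrite inE xS.
exists (S |: P); split.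
- move=> S'; rewrite !inE => /orP[/eqP->|/PA[S'A ->]] //; split=> //.
  exact: subset_trans S'A (subsetDl _ _).
- move=> S1 S2 x; rewrite !inE => /orP[/eqP->|p1] /orP[/eqP->|p2] // x1 x2.
  + by case: (dS _ _ p2 x1 x2).
  + by case: (dS _ _ p1 x2 x1).
  + exact: (Pd _ _ x).
- rewrite cardsU1 nSP; move: Pc; rewrite cD; nia.
Qed.

End Blocks.

(** * Turning the bipartite graph of part (3) into a union of cliques *)

Section BigraphBlocks.
Local Open Scope nat_scope.
Variables (B : sgraph) (U V : {set B}).
Hypothesis UV : bipartition U V.

Lemma bipartition_adj (x y : B) : adj x y -> (x \in U) = (y \in V).
Proof.
case/and3P: UV => /eqP UVT dUV /forallP/(_ x)/forallP/(_ y)/implyP h /h.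
have : y \in U :|: V by rewrite UVT.
have := disjointFr dUV (x := y); rewrite inE.
by case: (y \in U) => [->//|_]; case: (x \in U) => //=.
Qed.

Lemma bipartition_notin (x : B) : x \in V -> x \in U -> False.
Proof. by case/and3P: UV => _ /disjointFl h _ /h ->. Qed.

Definition nbrs (u : B) : {set B} := [set v | adj u v].

Lemma edges_le_degrees : #|edges B| <= \sum_(u in U) #|nbrs u|.
Proof.
under eq_bigr => u _ do rewrite -sum1_card.
rewrite pair_big_dep sum1dep_card /=.
apply: leq_trans (leq_imset_card (fun p : B * B => [set p.1; p.2]) _).
apply: subset_leq_card; apply/subsetP => e /edgesP[x [y [xy ->]]].
have [xU|xU] := boolP (x \in U).
  by apply/imsetP; exists (x, y); rewrite ?inE ?xU.
apply/imsetP; exists (y, x); last by rewrite setUC.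
rewrite !inE /= adj_sym xy andbT.
have := bipartition_adj xy; rewrite (negbTE xU) => /esym yV.
have : y \in U :|: V by case/and3P: UV => /eqP->.
by rewrite inE yV orbF.
Qed.

Variables (t : nat).
Hypothesis few_paths : {in V &, forall x y, x != y -> npaths_le 4 x y < t}.

Lemma npaths_le_ge (L l : nat) (x y : B) : l <= L ->
  #|[set p : l.-tuple B | [&& path (@adj B) x p, uniq (x :: p) & last x p == y]]|
  <= npaths_le L x y.
Proof.
move=> lL; rewrite /npaths_le (bigD1 (Ordinal (lL : l < L.+1))) //=.
exact: leq_addr.
Qed.

Lemma npaths2_ge (x y : B) (W : {set B}) : x != y -> x \in V -> y \in V ->
  (forall u, u \in W -> [/\ u \in U, adj u x & adj u y]) -> #|W| <= npaths_le 4 x y.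
Proof.
move=> xy xV yV WE; apply: leq_trans (@npaths_le_ge 4 2 x y isT).
pose f (u : B) : 2.-tuple B := [tuple u; y].
have fi : injective f by move=> u v [].
rewrite -(card_imset _ fi); apply: subset_leq_card.
apply/subsetP => _ /imsetP[u /WE[uU ux uy] ->]; rewrite inE /= adj_sym ux uy eqxx !inE.
rewrite !andbT /= negb_or xy andbT; apply/andP; split.
  by apply/eqP => e; apply: (bipartition_notin xV); rewrite e.
by apply/eqP => e; apply: (bipartition_notin yV); rewrite -e.
Qed.

Lemma npaths4_ge (x y : B) (W : {set B}) : x != y -> x \in V -> y \in V ->
  (forall w, w \in W -> [/\ w \in V, w != x, w != y & exists u u',
     [/\ u \in U, u' \in U, u != u' & [/\ adj u x, adj u w, adj u' w & adj u' y]]]) ->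
  #|W| <= npaths_le 4 x y.
Proof.
move=> xy xV yV WE; apply: leq_trans (@npaths_le_ge 4 4 x y isT).
(* A path [x, u, w, u', y] is listed without [x], so its middle vertex [w] has index 1. *)
apply: leq_trans (leq_imset_card (fun p : 4.-tuple B => nth x p 1) _).
apply: subset_leq_card; apply/subsetP => w /WE[wV wx wy [u [u' [uU u'U uu' [ux uw u'w u'y]]]]].
have nUV v v' : v \in U -> v' \in V -> v != v'.
  by move=> vU v'V; apply/eqP => e; apply: (bipartition_notin v'V); rewrite -e.
apply/imsetP; exists [tuple u; w; u'; y] => //.
rewrite inE /= adj_sym ux uw adj_sym u'w u'y eqxx !inE !negb_or.
rewrite (eq_sym x u) (eq_sym x u') (eq_sym w u') (eq_sym x w).
by rewrite xy wx wy uu' !nUV.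
Qed.

(** Chunking the neighbourhoods loses at most one block per vertex of [U], and the edges provide two
    on average; exactly [#|U|] are kept. A block carries its centre, so equal sets from different
    centres stay distinct. *)
Lemma exists_blocks (a : nat) : 0 < a -> 2 * a * #|U| <= #|edges B| ->
  exists J : {set B * {set B}}, [/\ #|J| = #|U|,
    forall i, i \in J -> [/\ i.1 \in U, i.2 \subset nbrs i.1 & #|i.2| = a] &
    forall i j x, i \in J -> j \in J -> i.1 = j.1 -> x \in i.2 -> x \in j.2 -> i = j].
Proof.
move=> a0 eB.
pose Q (u : B) (P : {set {set B}}) :=
  [&& [forall S in P, (S \subset nbrs u) && (#|S| == a)],
    [forall S in P, forall S' in P, (S :&: S' != set0) ==> (S == S')] &
    #|nbrs u| <= a * #|P|.+1].
have exQ u : exists P, Q u P.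
  have [P [PA Pd Pc]] := exists_chunks (nbrs u) a0; exists P; apply/and3P; split=> //.
    by apply/forall_inP => S /PA[-> ->] /=.
  apply/forall_inP => S PS; apply/forall_inP => S' PS'; apply/implyP => /set0Pn[x].
  by rewrite inE => /andP[xS xS']; apply/eqP/(Pd _ _ x).
pose P u := xchoose (exQ u).
have PQ u : Q u (P u) := xchooseP (exQ u).
pose E := [set i : B * {set B} | (i.1 \in U) && (i.2 \in P i.1)].
have cE : #|U| <= #|E|.
  have -> : #|E| = \sum_(u in U) #|P u|.
    under eq_bigr => u _ do rewrite -sum1_card.
    by rewrite pair_big_dep sum1dep_card.
  have := leq_trans eB edges_le_degrees.
  have h : \sum_(u in U) #|nbrs u| <= \sum_(u in U) (a * #|P u| + a).
    by apply: leq_sum => u _; have /and3P[_ _] := PQ u; rewrite mulnS addnC.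
  move/leq_trans/(_ h); rewrite big_split /= -big_distrr sum_nat_const /=; nia.
have [J JE Jc] := exists_subset_card cE.
exists J; split=> //.
  move=> i /(subsetP JE); rewrite inE => /andP[iU iP]; have /and3P[h _ _] := PQ i.1.
  by have /andP[-> /eqP->] := forall_inP h _ iP.
move=> [u S] [v S'] x /(subsetP JE) + /(subsetP JE); rewrite !inE /= => /andP[_ iP] /andP[_ jP] uv.
subst v => xS xS'; have /and3P[_ h _] := PQ u.
have /implyP h' := forall_inP (forall_inP h _ iP) _ jP.
congr pair; apply/eqP/h'; apply/set0Pn; exists x; exact/setIP.
Qed.

(** Blocks of one centre are disjoint, so blocks through [x] and [y] give paths of length 2 in [B],
    and detours give paths of length 4. *)
Lemma exists_clique_blowup (a r : nat) : 0 < a -> 2 * a * #|U| <= #|edges B| -> 1 < r ->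
  exists G : sgraph, [/\ #|G| = #|V|,
    #|U| * a ^_ r <= t * #|embeddings (complete_graph r) G| &
    #|embeddings (complete_bipartite 2 t) G| <= #|U| * a ^ 2 * (2 * t * a) ^ t].
Proof.
move=> a0 eB r1; have [J [Jc JE Jd]] := exists_blocks a0 eB.
pose W : finType := {x : B | x \in V}.
pose I : finType := {i : B * {set B} | i \in J}.
pose N (i : I) : {set W} := [set x | val x \in (val i).2].
have cI : #|I| = #|U| by rewrite card_sig -Jc; apply: eq_card => i; rewrite inE.
have IU (i : I) : (val i).1 \in U by have [] := JE _ (valP i).
have Iadj (i : I) (x : W) : x \in N i -> adj (val i).1 (val x).
  by rewrite inE => xi; have [_ /subsetP/(_ _ xi)] := JE _ (valP i); rewrite inE.
have Iinj (i j : I) (x : W) : (val i).1 = (val j).1 -> x \in N i -> x \in N j -> i = j.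
  rewrite !inE => ij xi xj; apply: val_inj.
  exact: (Jd _ _ (val x) (valP i) (valP j)).
have Na i : #|N i| = a.
  have [_ /subsetP sub <-] := JE _ (valP i); rewrite -(card_imset _ val_inj).
  apply: eq_card => x; apply/imsetP/idP => [[y] + ->|xi]; first by rewrite inE.
  have xV : x \in V.
    by rewrite -(bipartition_adj (x := (val i).1)) ?IU //; have := sub x xi; rewrite inE.
  by exists (exist _ x xV); rewrite ?inE.
have few (x y : W) : x != y -> npaths_le 4 (val x : B) (val y) < t.
  by move=> xy; apply: few_paths; rewrite ?(valP x) ?(valP y) // (inj_eq val_inj).
have few_blocks (x y : W) : x != y -> #|[set i | (x \in N i) && (y \in N i)]| < t.
  move=> xy; apply: leq_ltn_trans (few _ _ xy).
  rewrite -(card_in_imset (f := fun i : I => (val i).1)); last first.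
    move=> i j; rewrite [i \in _]inE [j \in _]inE => /andP[xi _] /andP[xj _] /= e.
    exact: (Iinj _ _ x).
  apply: npaths2_ge; rewrite ?(valP x) ?(valP y) ?(inj_eq val_inj) //.
  move=> u /imsetP[i + ->]; rewrite [_ \in _]inE => /andP[xi yi].
  by rewrite IU !Iadj.
have few_detours (x y : W) : x != y ->
    #|[set w : block_graph N | [&& adj (x : block_graph N) w, adj (y : block_graph N) w &
      ~~ [exists i, [&& x \in N i, w \in N i & y \in N i]]]]| < t.
  move=> xy; apply: leq_ltn_trans (few _ _ xy).
  rewrite -(card_imset _ val_inj).
  apply: npaths4_ge; rewrite ?(valP x) ?(valP y) ?(inj_eq val_inj) //.
  move=> _ /imsetP[w + ->]; rewrite inE.
  case/and3P=> /andP[xw /existsP[i /andP[xi wi]]] /andP[yw /existsP[j /andP[yj wj]]] h.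
  rewrite (valP w) !(inj_eq val_inj) ![w == _]eq_sym; split=> //.
  exists (val i).1, (val j).1; rewrite !IU !Iadj //; split=> //.
  (* With a common centre the two blocks through [w] coincide and contain [x], [w] and [y]. *)
  apply: contraNneq h => e; have ij := Iinj i j w e wi wj.
  by apply/existsP; exists i; rewrite xi wi ij.
exists (block_graph N); split.
- by rewrite card_sig; apply: eq_card => x; rewrite inE.
- by rewrite -cI; apply: block_clique_embeddings_ge.
- by rewrite -cI; apply: block_biclique_embeddings_le.
Qed.

End BigraphBlocks.

(** * Tools for averaging over finite sets *)

Section FiniteSums.
Variable R : realType.

(** Independence of the values of a uniform random function, cleared of denominators. *)
Lemma card_constraints (C D : finType) (S : {set C}) (v : C -> D) :
  (#|[set f : {ffun C -> D} | [forall c in S, f c == v c]]| * #|D| ^ #|S| = #|D| ^ #|C|)%N.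
Proof.
pose F (c : C) : pred D := if c \in S then pred1 (v c) else predT.
have -> : #|[set f : {ffun C -> D} | [forall c in S, f c == v c]]| = #|family F|.
  apply: eq_card => f; rewrite inE; apply/forall_inP/familyP => h c.
    by rewrite /F; case: ifP => // cS; rewrite inE h.
  by move=> cS; have := h c; rewrite /F cS inE.
rewrite card_family foldrE big_map big_enum /=.
rewrite -[(#|D| ^ #|S|)%N]prod_nat_const -[(#|D| ^ #|C|)%N]prod_nat_const.
rewrite big_mkcond [X in (_ * X)%N]big_mkcond -big_split /= [RHS]big_mkcond.
apply: eq_bigr => c _; rewrite /F; case: ifP => _; first by rewrite card1 mul1n.
by rewrite muln1.
Qed.

(* Group the maps J by a choice of representatives of their fibres: those with a
   given choice number at most q to the size of the image. *)
Lemma sum_inv_image (E : finType) (q : nat) : (0 < q)%N ->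
  \sum_(J : {ffun E -> 'I_q}) (q%:R ^+ #|[set J e | e : E]|)^-1 <= (#|E| ^ #|E|)%:R :> R.
Proof.
move=> q0; have qR : 0 < q%:R :> R by rewrite ltr0n.
pose rep (J : {ffun E -> 'I_q}) : {ffun E -> E} :=
  [ffun e => odflt e [pick e' | J e' == J e]].
have Jrep (J : {ffun E -> 'I_q}) e : J (rep J e) = J e.
  by rewrite ffunE; case: pickP => [e' /eqP|].
have repE (J : {ffun E -> 'I_q}) e e' : J e = J e' -> rep J e = rep J e'.
  move=> ee; rewrite !ffunE ee; case: pickP => // /(_ e'); by rewrite eqxx.
have cim (J : {ffun E -> 'I_q}) : #|[set J e | e : E]| = #|[set rep J e | e : E]|.
  have -> : [set J e | e : E] = J @: [set rep J e | e : E].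
    by rewrite -imset_comp; apply: eq_imset => e; rewrite /= Jrep.
  apply: card_in_imset => _ _ /imsetP[e _ ->] /imsetP[e' _ ->].
  by rewrite !Jrep => /repE.
rewrite (partition_big rep predT) //= -card_ffun -sum1_card natr_sum.
apply: ler_sum => rho _.
under eq_bigr => J /eqP e do rewrite cim e.
rewrite sumr_const -[leLHS]mulr_natr ler_pdivrMl ?exprn_gt0 // mulr1 -natrX ler_nat.
pose D : finType := {e : E | e \in [set rho e | e : E]}.
have -> : (q ^ #|[set rho e | e : E]| = #|{ffun D -> 'I_q}|)%N.
  by rewrite card_ffun card_ord card_sig; congr (_ ^ _)%N; apply: eq_card => e; rewrite inE.
pose res (J : {ffun E -> 'I_q}) : {ffun D -> 'I_q} := [ffun d => J (val d)].
rewrite -(card_in_imset (f := res) (D := [pred J | rep J == rho])); last first.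
  move=> J J'; rewrite !inE => /eqP eJ /eqP eJ' /ffunP e; apply/ffunP => x.
  have xD : rho x \in [set rho e | e : E] by apply: imset_f.
  have := e (exist _ (rho x) xD); rewrite !ffunE /= -{1}eJ -eJ'.
  by rewrite !Jrep.
exact: max_card.
Qed.

(* The left-hand side is log-linear in p and th and the two terms on the right
   balance when p^(2t-1) = th^t; the last hypothesis is the inequality there. *)
Lemma weight_le (p th : R) (m K t : nat) : 0 < p <= 1 -> 0 < th <= 1 -> (0 < t)%N ->
  (0 < m)%N -> (2 * t ^ 2 <= m * t + (2 * t - 1) * K)%N ->
  p ^+ m * th ^+ K <= p * th ^+ t + p ^+ (2 * t).
Proof.
move=> /andP[p0 p1] /andP[h0 h1] t0 m0 mK.
have ppos j : 0 <= p ^+ j by rewrite exprn_ge0 // ltW.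
have hpos j : 0 <= th ^+ j by rewrite exprn_ge0 // ltW.
have p0_ := ltW p0; have h0_ := ltW h0.
have [hp|ph] := lerP (th ^+ t) (p ^+ (2 * t - 1)).
  apply: (@le_trans _ _ (p ^+ (2 * t))); last by rewrite lerDr mulr_ge0 // ltW.
  have [tm|mt] := leqP (2 * t) m.
    apply: (@le_trans _ _ (p ^+ m)); first by rewrite ler_piMr // exprn_ile1.
    by rewrite ler_wiXn2l.
  have -> : p ^+ (2 * t) = p ^+ m * p ^+ (2 * t - m) by rewrite -exprD subnKC // ltnW.
  rewrite ler_wpM2l // -(@ler_pXn2r _ t) ?nnegrE //.
  rewrite -exprM mulnC exprM; apply: (@le_trans _ _ ((p ^+ (2 * t - 1)) ^+ K)).
    by rewrite lerXn2r ?nnegrE.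
  rewrite -!exprM; apply: ler_wiXn2l => //.
  have : (m <= 2 * t)%N by exact: ltnW.
  by rewrite -mulnn in mK; nia.
apply: (@le_trans _ _ (p * th ^+ t)); last by rewrite lerDl.
have -> : p ^+ m = p * p ^+ m.-1 by rewrite -exprS prednK.
rewrite -mulrA ler_wpM2l ?p0_ //.
have [tK|Kt] := leqP t K.
  apply: (@le_trans _ _ (th ^+ K)); first by rewrite ler_piMl // exprn_ile1.
  by rewrite ler_wiXn2l.
rewrite -[in leRHS](subnK (ltnW Kt)) exprD ler_wpM2r //.
rewrite -(@ler_pXn2r _ (2 * t - 1)) ?nnegrE //; last by lia.
rewrite -exprM mulnC exprM; apply: (@le_trans _ _ ((th ^+ t) ^+ m.-1)).
  by rewrite lerXn2r ?nnegrE // ltW.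
rewrite -!exprM; apply: ler_wiXn2l => //.
by rewrite -mulnn in mK; nia.
Qed.

(* Markov's inequality for [Y] together with a reverse one for the bounded [X]. *)
Lemma exists_large_small (T : finType) (X Y : T -> R) (A Z : R) : 0 < A -> 0 < Z ->
  (0 < #|T|)%N -> (forall w, X w <= A) -> (forall w, 0 <= Y w) ->
  3 / 4 * A * #|T|%:R <= \sum_w X w -> \sum_w Y w <= Z * #|T|%:R ->
  exists w, A / 4 <= X w /\ Y w <= 4 * Z.
Proof.
move=> A0 Z0 T0 XA Y0 hX hY; case: (boolP [exists w, (A / 4 <= X w) && (Y w <= 4 * Z)]) => [/existsP[w /andP[? ?]]|]; first by exists w.
rewrite negb_exists => /forallP no.
have : \sum_w X w <= \sum_w (A / 4 + A / (4 * Z) * Y w).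
  apply: ler_sum => w _; have := no w; rewrite negb_and -!ltNge.
  have h : 0 <= A / (4 * Z) * Y w by rewrite mulr_ge0 // divr_ge0 // ?mulr_ge0 // ltW.
  case/orP=> hw; first by rewrite (le_trans (ltW hw)) // lerDl.
  apply: (le_trans (XA w)).
  have : A <= A / (4 * Z) * Y w.
    by rewrite mulrAC ler_pdivlMr ?mulr_gt0 // ler_wpM2l // ltW.
  have : 0 < A / 4 by rewrite divr_gt0.
  lra.
rewrite big_split /= sumr_const -mulr_sumr -[_ *+ _]mulr_natr.
have h2 : A / (4 * Z) * \sum_w Y w <= A / 4 * #|T|%:R.
  have -> : A / 4 * #|T|%:R = A / (4 * Z) * (Z * #|T|%:R).
    by field; rewrite gt_eqF.
  by rewrite ler_wpM2l // divr_ge0 // ?mulr_ge0 // ltW.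
have T0' : 0 < A * #|T|%:R by rewrite mulr_gt0 ?ltr0n.
set S := \sum_w X w in hX *; set S' := _ * \sum_w Y w in h2 *.
rewrite -!mulrA [4^-1 * _]mulrC !mulrA in h2 *.
set W := A * #|T|%:R in T0' h2 *.
have : 3 / 4 * W <= S by rewrite /W mulrA.
lra.
Qed.

End FiniteSums.

(** * The random union of transversal cliques *)

Section RandomCliques.
Variables (a g q : nat).
Implicit Type Phi : {ffun 'I_q * 'I_a -> 'I_g}.

(** A uniform [Phi] is the random choice: clique [j] meets row [i] in the vertex [(i, Phi (j, i))].
    Expectations are written as sums over all [Phi]. *)
Definition transversal_block Phi (j : 'I_q) : {set 'I_a * 'I_g} :=
  [set w | Phi (j, w.1) == w.2].

Definition transversal_graph Phi : sgraph := block_graph (transversal_block Phi).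

Let Omega := #|{ffun 'I_q * 'I_a -> 'I_g}|.

Section Cliques.
Variables (r : nat) (i0 i1 : 'I_r).
Hypothesis i01 : i0 != i1.
Local Open Scope nat_scope.

Definition collide Phi (f : {ffun 'I_r -> 'I_a}) (j j' : 'I_q) : bool :=
  (Phi (j, f i0) == Phi (j', f i0)) && (Phi (j, f i1) == Phi (j', f i1)).

(** Labelled cliques whose first two vertices lie together in no other clique, so that the image
    determines [j]. *)
Definition lone Phi : {set {ffun 'I_r -> 'I_a} * 'I_q} :=
  [set p : {ffun 'I_r -> 'I_a} * 'I_q | injectiveb p.1 & [forall j, (j != p.2) ==> ~~ collide Phi p.1 j p.2]].

Lemma lone_le_embeddings Phi :
  #|lone Phi| <= #|embeddings (complete_graph r) (transversal_graph Phi)|.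
Proof.
pose F := complete_graph r.
pose h (p : {ffun 'I_r -> 'I_a} * 'I_q) : {ffun F -> transversal_graph Phi} :=
  [ffun i => (p.1 i, Phi (p.2, p.1 i))].
rewrite -(card_in_imset (f := h)).
  apply: subset_leq_card; apply/subsetP => _ /imsetP[[f j] + ->].
  rewrite inE => /andP[/injectiveP/= fi _]; apply/(@embeddingP F _ (h (f, j))).
  split=> [x y|x y xy]; rewrite !ffunE; first by case=> /fi.
  apply/andP; split; first by apply: contraNneq xy => -[/fi->].
  by apply/existsP; exists j; rewrite !inE /= !eqxx.
move=> [f j] [f' j']; rewrite !inE /= => /andP[_ /forallP/(_ j')] + /andP[_ _] /ffunP e.
have ef : f = f' by apply/ffunP => i; have := e i; rewrite !ffunE => -[].
subst f'; case: eqVneq => [->//|_] /=; rewrite /collide.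
have := e i0; have := e i1; rewrite !ffunE => -[->] [->].
by rewrite !eqxx.
Qed.

(** The probability of a collision is [1 / g ^ 2]. *)
Lemma card_collide (f : {ffun 'I_r -> 'I_a}) (j j' : 'I_q) : injective f -> j != j' ->
  #|[set Phi | collide Phi f j j']| * g ^ 2 = Omega.
Proof.
move=> fi jj; have f01 : f i0 != f i1 by rewrite (inj_eq fi).
pose S : {set 'I_q * 'I_a} := setX [set j; j'] [set f i0; f i1].
have S4 : #|S| = 4 by rewrite cardsX !cards2 jj f01.
have [g0|g0] := posnP g.
  rewrite [g in _ * g ^ 2]g0 muln0; apply/esym/eqP; rewrite -leqn0 leqNgt.
  apply/negP => /card_gt0P[Phi _].
  by have := Phi (j, f i0); rewrite g0 => -[].
(* Split by the [g ^ 2] possible pairs of common values; each prescribes [Phi] on the four cells of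
   [S]. *)
apply/eqP; rewrite -(eqn_pmul2r (_ : 0 < g ^ 2)) ?expn_gt0 ?g0 // -mulnA -expnD.
rewrite -sum1_card (partition_big (fun Phi => (Phi (j', f i0), Phi (j', f i1))) predT) //=.
rewrite big_distrl /= -[X in _ == _ * X ^ 2](card_ord g) -mulnn -card_prod mulnC -sum_nat_const.
apply/eqP/eq_big => // -[x y] _.
pose v (c : 'I_q * 'I_a) := if c.2 == f i0 then x else y.
rewrite /Omega card_ffun -(card_constraints S v) S4 card_ord sum1dep_card.
congr (_ * _); apply: eq_card => Phi; rewrite !inE /v xpair_eqE.
apply/andP/forall_inP => [[/andP[/eqP c0 /eqP c1] /andP[/eqP e0 /eqP e1]] [u w]|h].
  rewrite inE /= !inE => /andP[/orP[]/eqP-> /orP[]/eqP->]; rewrite ?eqxx.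
  - by rewrite c0 e0.
  - by rewrite (eq_sym (f i1)) (negbTE f01) c1 e1.
  - by rewrite e0.
  - by rewrite (eq_sym (f i1)) (negbTE f01) e1.
have hc u w : u \in [set j; j'] -> w \in [set f i0; f i1] -> Phi (u, w) = v (u, w).
  by move=> uj wf; apply/eqP/h; rewrite inE /= uj.
rewrite /collide !hc ?set21 ?set22 // /v /= !eqxx (eq_sym (f i1)) (negbTE f01).
by rewrite !eqxx.
Qed.

(** A union bound over the fewer than [q] other cliques: the expected number is at least
    [a ^_ r * q * (1 - q / g ^ 2)]. *)
Lemma sum_lone :
  a ^_ r * q * g ^ 2 * Omega <= g ^ 2 * (\sum_Phi #|lone Phi|) + a ^_ r * q ^ 2 * Omega.
Proof.
pose P := [set p : {ffun 'I_r -> 'I_a} * 'I_q | injectiveb p.1].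
have cP : #|P| = a ^_ r * q.
  rewrite -[a in RHS]card_ord -[r in RHS]card_ord -card_inj_ffuns -[q in RHS]card_ord.
  by rewrite -cardsT -cardsX; apply: eq_card => p; rewrite !inE andbT.
have -> : \sum_Phi #|lone Phi| =
    \sum_(p in P) #|[set Phi | p \in lone Phi]|.
  under eq_bigr => Phi _ do rewrite -sum1_card.
  rewrite (exchange_big_dep (mem P)) /=; last first.
    by move=> Phi p _; rewrite !inE => /andP[].
  by apply: eq_bigr => p _; rewrite sum1dep_card.
have -> : a ^_ r * q ^ 2 * Omega = \sum_(p in P) q * Omega.
  by rewrite sum_nat_const cP; ring.
have -> : a ^_ r * q * g ^ 2 * Omega = \sum_(p in P) g ^ 2 * Omega.
  by rewrite sum_nat_const cP mulnA.
rewrite big_distrr -big_split /=; apply: leq_sum => -[f j]; rewrite inE => /injectiveP/= fi.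
rewrite -[q * _](_ : \sum_(j' : 'I_q) Omega = _); last by rewrite sum_nat_const card_ord.
apply: (@leq_trans (g ^ 2 * (#|[set Phi | (f, j) \in lone Phi]| +
    \sum_(j' | j' != j) #|[set Phi | collide Phi f j' j]|))).
  rewrite leq_mul2l; apply/orP; right; rewrite /Omega -cardsT.
  rewrite -(cardsID [set Phi | (f, j) \in lone Phi]) setTI leq_add2l.
  apply: (@leq_trans #|\bigcup_(j' | j' != j) [set Phi | collide Phi f j' j]|).
    apply: subset_leq_card; apply/subsetP => Phi; rewrite !inE andbT /= negb_and.
    rewrite (introT (injectiveP _) fi) /= => /forallPn[j'].
    rewrite negb_imply negbK => /andP[jj cc].
    by apply/bigcupP; exists j'; rewrite ?inE.
  elim/big_rec2: _ => [|i n B _ IH]; first by rewrite cards0.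
  by apply: leq_trans (leq_card_setU _ _) _; rewrite leq_add2l.
rewrite mulnDr leq_add2l big_distrr [X in _ <= X](bigID (fun j' => j' != j)) /=.
apply: leq_trans (leq_addr _ _); apply: leq_sum => j' jj.
by rewrite mulnC card_collide.
Qed.

End Cliques.

Section Bicliques.
Variable t : nat.
Let F : finType := ('I_2 + 'I_t)%type.
Let E : finType := ('I_2 * 'I_t)%type.
Implicit Types (f : {ffun F -> 'I_a * 'I_g}) (J : {ffun E -> 'I_q}).
Local Open Scope nat_scope.

(** Here [J] assigns to each edge of [K_{2,t}] a clique that contains its image. *)
Definition fits f J Phi : bool :=
  [forall e : E, (f (inl e.1) \in transversal_block Phi (J e)) &&
                 (f (inr e.2) \in transversal_block Phi (J e))].

Definition lefts J (j : 'I_q) : {set 'I_2} := [set e.1 | e : E & J e == j].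
Definition rights J (j : 'I_q) : {set 'I_t} := [set e.2 | e : E & J e == j].
(* The number of (clique, vertex) incidences, i.e. of random choices that are
   prescribed when the edge e of K_{2,t} lies in the clique J e. *)
Definition ncells J : nat := \sum_j (#|lefts J j| + #|rights J j|).

Lemma card_fits f J : injective f ->
  #|[set Phi | fits f J Phi]| * g ^ ncells J <= Omega.
Proof.
move=> fi; have [->|[Phi0]] := set_0Vmem [set Phi | fits f J Phi].
  by rewrite cards0.
rewrite inE => /forallP fit0.
pose P : {set 'I_q * F} := [set c |
  match c.2 with inl i => i \in lefts J c.1 | inr i => i \in rights J c.1 end].
have cP : #|P| = ncells J.
  transitivity (\sum_(j : 'I_q) \sum_(x : F | (j, x) \in P) 1).
    rewrite pair_big_dep sum1dep_card; apply: eq_card => -[j x].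
    by rewrite [RHS]inE.
  apply: eq_bigr => j _; rewrite big_sumType /=.
  by congr (_ + _); rewrite sum1dep_card; apply: eq_card => i; rewrite !inE.
pose h (c : 'I_q * F) := (c.1, (f c.2).1).
have fitP Phi c : fits f J Phi -> c \in P -> Phi (h c) = (f c.2).2.
  move=> /forallP fit; case: c => j [i|i]; rewrite inE /= => /imsetP[e];
    rewrite inE => /eqP <- ->; have /andP[] := fit e; rewrite !inE; by move=> /eqP ? /eqP ?.
have fit0' : fits f J Phi0 by apply/forallP.
(* The prescribed cells are distinct: [Phi0] shows that a clique has one vertex per row, and [f] is
   injective. *)
have hi : {in P &, injective h}.
  move=> c c' cP' c'P e; have := fitP _ _ fit0' cP'; have := fitP _ _ fit0' c'P.
  rewrite e => -> e2; case: e => e1 e3; case: c c' e1 e2 e3 {cP' c'P} => [j x] [j' x'] /= -> e2 e3.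
  by congr pair; apply: fi; rewrite [LHS]surjective_pairing e3 -e2 -surjective_pairing.
rewrite /Omega card_ffun card_ord -cP -(card_in_imset hi).
rewrite -[g in X in _ <= X]card_ord -(card_constraints (h @: P) (fun c => Phi0 c)) card_ord leq_mul2r.
apply/orP; right; apply: subset_leq_card; apply/subsetP => Phi; rewrite !inE => fit.
apply/forall_inP => _ /imsetP[c cc ->]; by rewrite !fitP.
Qed.

(* A clique carrying e edges of K_{2,t} on v vertices satisfies
   t e <= t + (2t - 1)(v - 2); sum over the cliques. *)
Lemma ncells_ge J : 0 < t ->
  2 * t ^ 2 + 2 * (2 * t - 1) * #|[set J e | e : E]|
    <= #|[set J e | e : E]| * t + (2 * t - 1) * ncells J.
Proof.
move=> t0; set I := [set J e | e : E].
have e0 j : j \notin I -> [set e | J e == j] = set0.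
  move=> jI; apply/setP => e; rewrite !inE; apply: contraNF jI => /eqP<-.
  exact: imset_f.
have -> : 2 * t ^ 2 = \sum_(j in I) t * #|[set e | J e == j]|.
  rewrite -big_distrr /=; have -> : 2 * t ^ 2 = t * #|E|.
    by rewrite card_prod !card_ord; ring.
  congr (_ * _); rewrite -sum1_card (partition_big_imset J) /=.
  by apply: eq_bigr => j _; rewrite sum1dep_card.
have -> : ncells J = \sum_(j in I) (#|lefts J j| + #|rights J j|).
  rewrite /ncells (bigID (mem I)) /= [X in _ + X]big1 ?addn0 // => j jI.
  by rewrite /lefts /rights e0 // !imset0 !cards0.
rewrite [2 * _ * _]mulnC -!sum_nat_const big_distrr -!big_split /=.
apply: leq_sum => j /imsetP[e _ ej].
have le : #|[set e' | J e' == j]| <= #|lefts J j| * #|rights J j|.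
  rewrite -cardsX; apply: subset_leq_card; apply/subsetP => e' e'j.
  by rewrite inE !imset_f.
have l0 : 0 < #|lefts J j| by apply/card_gt0P; exists e.1; apply: imset_f; rewrite inE ej.
have r0 : 0 < #|rights J j| by apply/card_gt0P; exists e.2; apply: imset_f; rewrite inE ej.
have l2 : #|lefts J j| <= 2 by have := max_card (mem (lefts J j)); rewrite card_ord.
have rt : #|rights J j| <= t by have := max_card (mem (rights J j)); rewrite card_ord.
move: le l0 r0 l2 rt; move: #|[set _ | _]| #|lefts J j| #|rights J j| => m A B mAB A0 B0 A2 Bt.
have tm : t * m <= t * (A * B) by rewrite leq_mul2l mAB orbT.
have AA : A = 1 \/ A = 2 by lia.
have h : t * (A * B) + (2 * t - 1) * 2 <= t + (2 * t - 1) * (A + B).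
  by case: t t0 Bt AA {mAB tm} => // u _ Bt [] ->; nia.
by apply: leq_trans h; lia.
Qed.

Lemma ncells_ge2 J : 2 * #|[set J e | e : E]| <= ncells J.
Proof.
rewrite /ncells (bigID (fun j => j \in [set J e | e : E])) /=.
apply: leq_trans (leq_addr _ _); rewrite mulnC -sum_nat_const.
apply: leq_sum => _ /imsetP[e _ ->]; apply: (@leq_add 1 1).
  by apply/card_gt0P; exists e.1; apply: imset_f; rewrite inE.
by apply/card_gt0P; exists e.2; apply: imset_f; rewrite inE.
Qed.

Lemma biclique_embeddings_le_fits Phi :
  #|embeddings (complete_bipartite 2 t) (transversal_graph Phi)|
  <= \sum_(f : {ffun F -> 'I_a * 'I_g} | injectiveb f) \sum_(J | fits f J Phi) 1.
Proof.
rewrite -sum1_card big_mkcond [X in _ <= X]big_mkcond /=; apply: leq_sum => f _.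
case: ifP => // /(@embeddingP (complete_bipartite 2 t) (transversal_graph Phi) f)[fi hom].
rewrite (introT (injectiveP _) fi).
have ex (e : E) : exists j, (f (inl e.1) \in transversal_block Phi j) &&
    (f (inr e.2) \in transversal_block Phi j).
  by have /andP[_ /existsP] := hom (inl e.1) (inr e.2) isT.
rewrite sum1dep_card; apply/card_gt0P; exists [ffun e => xchoose (ex e)].
by rewrite inE; apply/forallP => e; rewrite ffunE; apply: (xchooseP (ex e)).
Qed.

(** There are at most [(a * g) ^ (2 + t)] maps [f]; for each, a union bound over [J]. By [weight_le]
    with [th = 1 / g], the two extreme patterns dominate, and [sum_inv_image] bounds the number of
    patterns. *)
Lemma sum_biclique_embeddings (R : realType) (p := q%:R / g%:R ^+ 2 : R) :
  0 < t -> 0 < g -> 0 < q -> (q <= g ^ 2)%N ->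
  (\sum_Phi #|embeddings (complete_bipartite 2 t) (transversal_graph Phi)|%:R
   <= (a * g)%:R ^+ (2 + t) * ((2 * t) ^ (2 * t))%:R
      * (p * (g%:R ^- t) + p ^+ (2 * t)) * Omega%:R)%R.
Proof.
move=> t0 g0 q0 qg; have gR : (0 < g%:R :> R)%R by rewrite ltr0n.
have qR : (0 < q%:R :> R)%R by rewrite ltr0n.
have p01 : (0 < p <= 1)%R.
  by rewrite divr_gt0 ?exprn_gt0 //= ler_pdivrMr ?exprn_gt0 // mul1r -natrX ler_nat.
have h01 : (0 < (g%:R^-1 : R) <= 1)%R by rewrite invr_gt0 gR /= invf_le1 // ler1n.
set W : R := (p * _ + _)%R.
have W0 : (0 <= W)%R.
  case/andP: p01 => p0 _; rewrite addr_ge0 ?mulr_ge0 ?invr_ge0 ?exprn_ge0 ?ltW //.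
rewrite -natr_sum.
apply: (@le_trans _ _ (\sum_(f : {ffun F -> 'I_a * 'I_g} | injectiveb f) \sum_J
    #|[set Phi | fits f J Phi]|)%:R).
  rewrite ler_nat; apply: leq_trans (leq_sum _ _) _.
    by move=> Phi _; apply: biclique_embeddings_le_fits.
  rewrite exchange_big /=; apply: leq_sum => f _; rewrite (exchange_big_dep predT) //=.
  by apply: leq_sum => J _; rewrite sum1dep_card.
rewrite natr_sum.
apply: (@le_trans _ _ (\sum_(f : {ffun F -> 'I_a * 'I_g} | injectiveb f)
    (((2 * t) ^ (2 * t))%:R * W * Omega%:R))%R).
  apply: ler_sum => f /injectiveP fi; rewrite natr_sum.
  have -> : ((2 * t) ^ (2 * t) = #|E| ^ #|E|)%N by rewrite card_prod !card_ord.
  rewrite -mulrA; apply: (@le_trans _ _ (\sum_(J : {ffun E -> 'I_q}) (q%:R ^+ #|[set J e | e : E]|)^-1 * (W * Omega%:R))%R).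
    apply: ler_sum => J _; pose m := #|[set J e | e : E]|; pose c := ncells J.
    have := card_fits J fi; rewrite -/c -(ler_nat R) natrM natrX.
    rewrite -ler_pdivlMr ?exprn_gt0 // => /le_trans; apply.
    rewrite [leLHS]mulrC mulrA ler_wpM2r ?ler0n //.
    rewrite ler_pdivlMl ?exprn_gt0 // -/m.
    (* Each of the [m] cliques used takes two of its cells into a factor [p]; the other cells weigh
       [1 / g] each. *)
    have -> : (q%:R ^+ m * (g%:R ^+ c)^-1 = p ^+ m * g%:R^-1 ^+ (c - 2 * m) :> R)%R.
      rewrite -[c in LHS](subnKC (ncells_ge2 J)) -/m -/c exprD invfM.
      by rewrite /p expr_div_n -exprM exprVn mulrA.
    rewrite /W -exprVn; apply: weight_le => //.
      apply/card_gt0P; exists (J (ord0, Ordinal t0)); exact: imset_f.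
    have := ncells_ge J t0; have := ncells_ge2 J; rewrite -/m -/c -mulnn; nia.
  by rewrite -mulr_suml ler_wpM2r ?mulr_ge0 ?ler0n // sum_inv_image.
rewrite sumr_const -[leLHS]mulr_natl !mulrA !ler_wpM2r ?ler0n //.
rewrite -natrX ler_nat.
apply: leq_trans (max_card _) _; rewrite card_ffun card_sum card_prod !card_ord.
by [].
Qed.

End Bicliques.

End RandomCliques.

(** * The upper bound of part (2) *)

Section RandomConstruction.
Variable R : realType.

(** By [4 * q <= g ^ 2] the average number of lone cliques is at least [3 / 4] of its maximum
    [a ^_ r * q], so [exists_large_small] applies. *)
Lemma exists_random_graph (a g q r t : nat) :
  (1 < r <= a)%N -> (0 < t)%N -> (0 < g)%N -> (0 < q)%N -> (4 * q <= g ^ 2)%N ->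
  let p := q%:R / g%:R ^+ 2 : R in
  exists G : sgraph, [/\ #|G| = (a * g)%N,
    (a ^_ r * q)%:R <= 4 * #|embeddings (complete_graph r) G|%:R :> R &
    #|embeddings (complete_bipartite 2 t) G|%:R
      <= 4 * ((a * g)%:R ^+ (2 + t) * ((2 * t) ^ (2 * t))%:R
              * (p * g%:R ^- t + p ^+ (2 * t)))].
Proof.
move=> /andP[r1 ra] t0 g0 q0 qg p.
pose i0 : 'I_r := Ordinal (ltnW r1); pose i1 : 'I_r := Ordinal r1.
have i01 : i0 != i1 by [].
have r0 : (0 < r)%N by apply: ltnW.
have a0 : (0 < a)%N by apply: leq_trans ra.
have gR : 0 < g%:R :> R by rewrite ltr0n.
have qR : 0 < q%:R :> R by rewrite ltr0n.
have p0 : 0 < p by rewrite divr_gt0 // exprn_gt0.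
set A := (a ^_ r * q)%N; set Z : R := _ * (_ + _).
have A0 : (0 < A)%N by rewrite muln_gt0 ffact_gt0 ra.
pose O := {ffun 'I_q * 'I_a -> 'I_g}.
have O0 : (0 < #|O|)%N by rewrite card_ffun card_ord expn_gt0 g0.
have Z0 : 0 < Z.
  have W0 : 0 < p * g%:R ^- t + p ^+ (2 * t).
    by rewrite addr_gt0 ?mulr_gt0 ?invr_gt0 ?exprn_gt0.
  apply: mulr_gt0 W0; apply: mulr_gt0; last by rewrite ltr0n expn_gt0 muln_gt0 t0.
  by apply: exprn_gt0; rewrite ltr0n muln_gt0 a0.
have := @exists_large_small R O (fun Phi => #|lone i0 i1 Phi|%:R)
  (fun Phi => #|embeddings (complete_bipartite 2 t) (transversal_graph Phi)|%:R) A%:R Z.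
case=> //; rewrite ?ltr0n //.
- move=> Phi; rewrite ler_nat /A -[a in (a ^_ _)%N]card_ord -[r in (_ ^_ r)%N]card_ord.
  rewrite -card_inj_ffuns -[q in (_ * q)%N]card_ord -cardsT -cardsX.
  apply: subset_leq_card; apply/subsetP => f; rewrite !inE andbT.
  by case/andP.
- rewrite -natr_sum; have := @sum_lone a g q r i0 i1 i01; rewrite -/A -/O.
  set S := (\sum_Phi _)%N; set N := #|_| => h.
  have : (3 * A * N <= 4 * S)%N.
    have g2 : (0 < g ^ 2)%N by rewrite expn_gt0 g0.
    rewrite -(leq_pmul2l g2).
    have e : (a ^_ r * q ^ 2 * N * 4 <= A * g ^ 2 * N)%N.
      have -> : (a ^_ r * q ^ 2 * N * 4 = A * (4 * q) * N)%N by rewrite /A; ring.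
      by rewrite leq_mul2r leq_mul2l qg !orbT.
    have e1 : (g ^ 2 * (3 * A * N) = 3 * (A * g ^ 2 * N))%N by ring.
    have e2 : (g ^ 2 * (4 * S) = 4 * (g ^ 2 * S))%N by ring.
    rewrite e1 e2; lia.
  rewrite -(ler_nat R) !natrM => h'; lra.
- by apply: sum_biclique_embeddings => //; lia.
move=> Phi [cl bi]; exists (transversal_graph Phi); split=> //.
  by rewrite card_prod !card_ord.
apply: (@le_trans _ _ (4 * #|lone i0 i1 Phi|%:R)); first by rewrite -ler_pdivrMl // mulrC.
by rewrite ler_wpM2l // ler_nat lone_le_embeddings.
Qed.

Lemma truncn_ge_half (x : R) : 1 <= x -> x <= 2 * (Num.truncn x)%:R.
Proof.
move=> x1; have h := truncnS_gt x.
have : 1 <= (Num.truncn x)%:R :> R by rewrite ler1n truncn_ge_nat // (le_trans ler01).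
by rewrite -natr1 in h; lra.
Qed.

(** The hypothesis [x <= y ^+ (2 * s + 1)] means [k n^(3/2) <= n^(s+2)]; it keeps the parameters in
    range. *)
Lemma random_graph_monomials (t s n : nat) (x y : R) :
  (0 < s < t)%N -> (0 < n)%N -> 1 <= x -> 1 <= y ->
  n%:R = y ^+ (2 * den t s) -> x <= y ^+ (2 * s + 1) ->
  (16 * s.+2)%:R <= dcrit t x y ->
  exists G : sgraph, [/\ #|G| = n,
    ecrit t s x y * dcrit t x y ^+ s
      <= (16 ^ s.+2 * 8)%:R * #|embeddings (complete_graph s.+2) G|%:R :> R &
    #|embeddings (complete_bipartite 2 t) G|%:R
      <= (8 * (2 * t) ^ (2 * t))%:R * (ecrit t s x y * dcrit t x y ^+ t)].
Proof.
case/andP=> s0 st n0 x1 y1 ny xy ad; have t0 : (0 < t)%N by lia.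
have rA (a : nat) : (2 * s.+2 <= a)%N -> (1 < s.+2 <= a)%N && (0 < a)%N by clear; lia.
have tt : (2 * t - 1 = t + t.-1)%N by clear -t0; lia.
have dd : (den t s = 2 * (t * s) - s + t)%N by rewrite /den mulnBl; clear; lia.
have ts : (s <= t * s)%N by rewrite leq_pmull.
(* Exponents of [y] behind [d <= n], [M <= n ^+ 2] and [n * d <= M], once [x] is replaced by
   [y ^+ (2 * s + 1)]. *)
have dn_exp : (((2 * s + 1) * (2 * t - 1)).+1 <= 2 * den t s)%N.
  by rewrite dd mulnBr mulnDl muln1 mul1n -mulnA; clear -ts t0; nia.
have Me : (3 * t + (6 * t - 4) * s = 3 * t + 6 * (t * s) - 4 * s)%N.
  by rewrite mulnBl; clear -ts; lia.
have Mn_exp : ((2 * s + 1) * t + (3 * t + (6 * t - 4) * s) <= 2 * den t s * 2)%N.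
  by rewrite dd Me mulnDl -mulnA [(s * t)%N]mulnC; clear -ts; lia.
have nM_exp : ((2 * s + 1) * t.-1 + (2 * den t s).+1 <= 3 * t + (6 * t - 4) * s)%N.
  have st1 : (s * t.-1 = t * s - s)%N by rewrite -subn1 mulnBr muln1 mulnC.
  by rewrite dd Me mulnDl -mulnA st1; clear -ts t0; lia.
have x0 : 0 <= x by apply: le_trans x1.
have y0 : 0 <= y by apply: le_trans y1.
have nR : 0 < n%:R :> R by rewrite ltr0n.
have xyj j : x ^+ j <= y ^+ ((2 * s + 1) * j).
  by rewrite exprM lerXn2r ?nnegrE ?exprn_ge0.
have Mdense := @ecrit_dense R t s x y t0.
move: ad Mdense; set d := dcrit t x y; set M := ecrit t s x y => ad Mdense.
have d1 : 1 <= d by apply: le_trans ad; rewrite ler1n.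
have dgt0 : 0 < d by apply: lt_le_trans d1.
have dn : d <= n%:R.
  rewrite ny /d /dcrit; apply: (@le_trans _ _ (y ^+ ((2 * s + 1) * (2 * t - 1)) * y)).
    by rewrite ler_wpM2r.
  by rewrite -exprSr ler_weXn2l.
have Mn : M <= n%:R ^+ 2.
  rewrite ny /M /ecrit -exprM.
  apply: (@le_trans _ _ (y ^+ ((2 * s + 1) * t) * y ^+ (3 * t + (6 * t - 4) * s))).
    by rewrite ler_wpM2r ?exprn_ge0.
  by rewrite -exprD ler_weXn2l.
have nM : n%:R * d <= M.
  rewrite ny /M /ecrit /d /dcrit.
  rewrite tt exprD mulrCA -!mulrA ler_wpM2l ?exprn_ge0 //.
  apply: (@le_trans _ _ (y ^+ ((2 * s + 1) * t.-1) * (y ^+ (2 * den t s) * y))).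
    by rewrite ler_wpM2r // mulr_ge0 ?exprn_ge0.
  by rewrite -exprSr -exprD ler_weXn2l.
have M0 : 0 <= M by apply: le_trans nM; rewrite mulr_ge0 // ltW.
clearbody d M.
(* Cliques of size about [d], as many as give about [M] edges, on about [n] vertices. Then
   [n * d <= M] makes [q] positive, and [M <= n ^+ 2] gives [4 * q <= g ^ 2]. *)
pose a := Num.truncn (d / 4); pose q := Num.truncn (M / d ^+ 2); pose g := (n %/ a)%N.
have d41 : 4 * s.+2%:R <= d / 4 by rewrite ler_pdivlMr // mulrAC -natrM -natrM.
have s2 : 1 <= s.+2%:R :> R by rewrite ler1n.
have ale : a%:R <= d / 4 by rewrite truncn_le // divr_ge0 // ltW.
have age : d <= 8 * a%:R.
  have : 1 <= d / 4 by lra.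
  by move/truncn_ge_half; rewrite -/a; lra.
have ra : (2 * s.+2 <= a)%N.
  rewrite -(ler_nat R) natrM; lra.
have /andP[ra' a0] := rA _ ra.
have aR : 0 < a%:R :> R by rewrite ltr0n.
have ad_le : a%:R <= d by lra.
have an : (a <= n)%N by rewrite -(ler_nat R) (le_trans ad_le).
have g0 : (0 < g)%N by rewrite divn_gt0.
have gR : 0 < g%:R :> R by rewrite ltr0n.
have agn : (a * g <= n)%N by rewrite mulnC leq_trunc_div.
have gn : 2 * n%:R <= g%:R * d.
  have : (n <= 2 * (g * a))%N by have := divn_eq n a; have := ltn_pmod n a0; rewrite -/g; clear -g0; nia.
  rewrite -(ler_nat R) !natrM => h; apply: (@le_trans _ _ (4 * (g%:R * a%:R))); first lra.
  have -> : 4 * (g%:R * a%:R) = g%:R * (4 * a%:R) :> R by ring.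
  by rewrite ler_wpM2l ?(ltW gR) //; lra.
have d2 : 0 < d ^+ 2 by rewrite exprn_gt0.
have q1 : 1 <= M / d ^+ 2.
  by rewrite ler_pdivlMr // mul1r; apply: le_trans nM; rewrite expr2 ler_wpM2r // ltW.
have qle : q%:R * d ^+ 2 <= M.
  by rewrite -ler_pdivlMr // truncn_le // (le_trans ler01).
have qge : M <= 2 * q%:R * d ^+ 2.
  by rewrite -ler_pdivrMr //; apply: truncn_ge_half.
have q0 : (0 < q)%N by rewrite truncn_gt0.
have gn2 : 4 * n%:R ^+ 2 <= g%:R ^+ 2 * d ^+ 2.
  have -> : 4 * n%:R ^+ 2 = (2 * n%:R) ^+ 2 :> R by ring.
  by rewrite -exprMn lerXn2r ?nnegrE // mulr_ge0 ?(ltW dgt0) ?(ltW gR).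
have qg : (4 * q <= g ^ 2)%N.
  rewrite -(ler_nat R) natrM natrX -(ler_pM2r d2); apply: le_trans gn2.
  by rewrite -mulrA ler_wpM2l // (le_trans qle).
have [G [cG cl bi]] := exists_random_graph ra' t0 g0 q0 qg.
have [|G' [cG' cl' bi']] := @exists_pad G n; first by rewrite cG.
exists G'; split=> //.
  apply: (@le_trans _ _ ((16 ^ s.+2 * 8)%:R * #|embeddings (complete_graph s.+2) G|%:R)); last first.
    by rewrite ler_wpM2l // ler_nat.
  (* Per vertex, 8 comes from [d <= 8 * a] and 2 from the falling factorial; the final 8 is 4 from
     the random graph times 2 from truncating [q]. *)
  apply: (@le_trans _ _ ((16 ^ s.+2 * 2)%:R * (a ^_ s.+2 * q)%:R)); last first.
    rewrite -natrM in cl *; move: cl; rewrite -!natrM !ler_nat; clear; nia.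
  rewrite -(ler_pM2r d2).
  have -> : M * d ^+ s * d ^+ 2 = d ^+ s.+2 * M by rewrite -mulrA -exprD addn2 mulrC.
  apply: (@le_trans _ _ ((8 ^ s.+2 * 2 ^ s.+2 * a ^_ s.+2)%N%:R * (2 * q%:R * d ^+ 2))); last first.
    have -> : (16 ^ s.+2 = 8 ^ s.+2 * 2 ^ s.+2)%N by rewrite -expnMn.
    by rewrite !natrM le_eqVlt; apply/orP; left; apply/eqP; ring.
  apply: ler_pM; rewrite ?exprn_ge0 // ?(ltW dgt0) //.
  apply: (@le_trans _ _ ((8 ^ s.+2 * a ^ s.+2)%N%:R)).
    by rewrite -expnMn natrX natrM lerXn2r ?nnegrE ?mulr_ge0 ?(ltW dgt0).
  by rewrite ler_nat -mulnA leq_mul2l expn_le_ffact ?orbT.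
rewrite bi' //; apply: (le_trans bi); rewrite [in leRHS]natrM -[leRHS]mulrA.
have -> : 8 * (((2 * t) ^ (2 * t))%:R * (M * d ^+ t)) =
  4 * (((2 * t) ^ (2 * t))%:R * (2 * (M * d ^+ t))) :> R by ring.
rewrite ler_wpM2l // [leLHS]mulrAC [leLHS]mulrC ler_wpM2l //.
set p := q%:R / _.
have p0 : 0 <= p by rewrite divr_ge0 ?exprn_ge0.
(* Each of the two dominant patterns contributes at most [M * d ^+ t]: the first since
   [q * a ^ 2 <= M], the second by [p <= M / n ^+ 2] and [ecrit_dense]. *)
rewrite mulrDr mulr2n mulrDl mul1r; apply: lerD.
  have -> : (a * g)%:R ^+ (2 + t) * (p * g%:R ^- t) = a%:R ^+ t * (q%:R * a%:R ^+ 2).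
    rewrite natrM exprMn !exprD /p.
    have h j : g%:R ^+ j != 0 :> R by rewrite expf_neq0 // gt_eqF.
    by have := h 2; have := h t; set u := g%:R ^+ t; set v := g%:R ^+ 2 => *; field; apply/andP.
  rewrite [leRHS]mulrC; apply: ler_pM; rewrite ?mulr_ge0 ?exprn_ge0 ?(ltW dgt0) //.
    by rewrite lerXn2r ?nnegrE ?(ltW dgt0).
  by apply: le_trans qle; rewrite ler_wpM2l // lerXn2r ?nnegrE ?(ltW dgt0).
rewrite -ny in Mdense.
apply: (@le_trans _ _ (n%:R ^+ (2 + t) * (M / n%:R ^+ 2) ^+ (2 * t))).
  apply: ler_pM; rewrite ?exprn_ge0 //.
    by rewrite lerXn2r ?nnegrE // ler_nat.
  rewrite lerXn2r ?nnegrE // ?divr_ge0 ?exprn_ge0 //.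
  rewrite ler_pdivrMr ?exprn_gt0 // mulrAC ler_pdivlMr ?exprn_gt0 // -(ler_pM2r d2).
  rewrite mulrAC -[leRHS]mulrA; apply: ler_pM; rewrite ?mulr_ge0 ?exprn_ge0 ?(ltW dgt0) //.
  by apply: le_trans gn2; rewrite ler_peMl ?exprn_ge0 // ler1n.
rewrite expr_div_n mulrA ler_pdivrMr ?exprn_gt0 ?exprn_gt0 //.
rewrite exprD mulrAC [_ ^+ 2 * _]mulrC -Mdense -exprM -!mulrA -!exprD.
by have -> : (3 * t + t = 2 * (2 * t))%N by clear; lia.
Qed.

End RandomConstruction.

Lemma sparse_construction (R : realType) (t s : nat) : (0 < s < t)%N ->
  exists c C : R, [/\ 0 < c, 0 < C &
    forall (n : nat) (k : R), (16 * t.+1)%:R ^+ t <= k ->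
      k * n%:R `^ (3 / 2) <= n%:R ^+ s.+2 ->
      exists G : sgraph, [/\ #|G| = n,
        c * (k * n%:R `^ (3 / 2)) <= (ncopies (complete_graph s.+2) G)%:R &
        (ncopies (complete_bipartite 2 t) G)%:R <= C * bound2 s.+2 t n k]].
Proof.
move=> st; case/andP: (st) => s0 s_t; have t0 : (0 < t)%N by lia.
pose F := complete_graph s.+2.
pose c' : R := (16 ^ s.+2 * 8)%N%:R * (#|F| ^ #|F|)%N%:R.
have c0 : 0 < c'.
  have F0 : (0 < #|F| ^ #|F|)%N by rewrite expn_gt0 card_ord.
  by rewrite mulr_gt0 ?ltr0n // muln_gt0 expn_gt0.
exists c'^-1, (8 * (2 * t) ^ (2 * t))%:R; rewrite invr_gt0 c0; split=> //.
  by rewrite ltr0n muln_gt0 expn_gt0 muln_gt0 t0.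
move=> n k Ak; have k1 : 1 <= k.
  by apply: le_trans Ak; rewrite exprn_ege1 // ler1n.
have [x [y [z [[x1 y0 z1 y1] [kx kz ny n3] _ ->]]]] := @bound_monomials R t s n k t0 s0 k1.
have [n0|n0] := posnP n.
  have [|G [cG _ bi]] := @exists_pad (complete_graph 0) n; first by rewrite card_ord.
  move=> _; exists G; split=> //.
    by rewrite n0 powR0 ?mulr0 ?mulr0 ?ler0n // gt_eqF // divr_gt0.
  apply: (@le_trans _ _ 0); last by rewrite !mulr_ge0 ?exprn_ge0 // (le_trans _ x1).
  rewrite lern0 -leqn0; apply: leq_trans (ncopies_le_embeddings _ _) _.
  by rewrite bi // card_biclique_embeddings big1 // => -[].
have {}y1 := y1 n0; have x0 : 0 <= x by apply: le_trans x1.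
rewrite n3 kx ny -exprM => kn.
(* Cancel [n^(3/2)] in [kn] and take the root of order [den t s]. *)
have xy : x <= y ^+ (2 * s + 1).
  have d0 : (0 < den t s)%N by rewrite addn_gt0 t0 orbT.
  rewrite -(@ler_pXn2r _ (den t s)) ?nnegrE ?exprn_ge0 // -exprM.
  have yp : 0 < y ^+ (3 * den t s) by rewrite exprn_gt0 // (lt_le_trans _ y1).
  rewrite -(ler_pM2r yp) -exprD; apply: (le_trans kn).
  by rewrite ler_weXn2l //; clear; nia.
have ad : (16 * t.+1)%:R <= dcrit t x y.
  by apply: (@le_dcrit R t s); rewrite -?kx // ler1n.
have [|G [cG cl bi]] := random_graph_monomials st n0 x1 y1 ny xy.
  by apply: le_trans ad; rewrite ler_nat leq_mul2l ltnS.
exists G; split=> //.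
  rewrite ler_pdivrMl // -ecrit_clique //; apply: (le_trans cl).
  rewrite -[leRHS]mulrA ler_wpM2l //; exact: embeddings_card_le.
rewrite -ecrit_biclique //; apply: le_trans bi.
by rewrite ler_nat ncopies_le_embeddings.
Qed.

(** * The upper bound of part (3) *)

Lemma powR_neg_root (R : realType) (z : R) (s j : nat) : 0 <= z -> (0 < s)%N ->
  (z ^+ s) `^ (- j%:R / s%:R) = z ^- j.
Proof.
move=> z0 s0; have sR : s%:R != 0 :> R by rewrite pnatr_eq0 -lt0n.
rewrite -powR_mulrn // -powRrM -[in RHS]powR_mulrn // -powRN; congr (_ `^ _).
by field.
Qed.

Section FewPaths.
Variables (R : realType) (t s : nat).
Hypothesis st : (0 < s < t)%N.
Let s0 : (0 < s)%N. Proof. by case/andP: st. Qed.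
Let t0 : (0 < t)%N. Proof. by case/andP: st => ? /ltnW; lia. Qed.

Lemma few_paths_dense_blocks (b : R) (n : nat) (k : R) (B : sgraph) (U V : {set B}) (z N3 : R) :
  0 < b -> 0 < z -> 0 <= N3 -> (4 * s.+2)%:R <= b * z ->
  few_paths_bigraph s.+2 t n k b U V -> 1 <= z ^- 2 * N3 ->
  #|U| = Num.truncn (z ^- 2 * N3) -> b * (z^-1 * N3) <= #|edges B|%:R ->
  exists G : sgraph, [/\ #|G| = n,
    z ^+ s * N3 <= 2 * t%:R * (8 / b) ^+ s.+2 * #|embeddings (complete_graph s.+2) G|%:R &
    #|embeddings (complete_bipartite 2 t) G|%:R
      <= b ^+ t.+2 * (2 * t)%:R ^+ t * (z ^+ t * N3)].
Proof.
move=> b0 z0 N30 bz [UV _ Vn _ fp] u1 Uu eB.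
(* The prescribed number of edges is [b * z * u] and [#|U| <= u], so this [a] satisfies
   [2 * a * #|U| <= #|edges B|]. *)
set u := z ^- 2 * N3 in u1 Uu; pose a := Num.truncn (b * z / 2).
have s2 : 1 <= s.+2%:R :> R by rewrite ler1n.
have bz2 : 2 * s.+2%:R <= b * z / 2.
  by rewrite natrM in bz; lra.
have ra : (2 * s.+2 <= a)%N.
  by rewrite truncn_ge_nat ?natrM // (le_trans _ bz2) // mulr_ge0.
have ale : a%:R <= b * z / 2 by rewrite truncn_le // (le_trans _ bz2) // mulr_ge0.
have age : b * z <= 4 * a%:R.
  have /truncn_ge_half : 1 <= b * z / 2 by lra.
  by rewrite -/a; lra.
have Ule : #|U|%:R <= u by rewrite Uu truncn_le // (le_trans ler01).
have Uge : u <= 2 * #|U|%:R by rewrite Uu truncn_ge_half.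
have aU : (2 * a * #|U| <= #|edges B|)%N.
  rewrite -(ler_nat R); apply: le_trans eB.
  rewrite !natrM; have -> : b * (z^-1 * N3) = b * z * u.
    by rewrite /u; field; rewrite gt_eqF.
  by apply: ler_pM => //; lra.
have a0 : (0 < a)%N by apply: leq_trans ra.
have [G [cG cl bi]] := exists_clique_blowup UV fp (r := s.+2) a0 aU isT.
have zs : z ^+ s * N3 = z ^+ s.+2 * u.
  by rewrite /u -addn2 exprD; field; rewrite gt_eqF.
exists G; split; first by rewrite cG.
  rewrite zs; rewrite -(ler_nat R) natrM [X in _ <= X]natrM in cl.
  have -> : 2 * t%:R * (8 / b) ^+ s.+2 * #|embeddings (complete_graph s.+2) G|%:R =
     (8 / b) ^+ s.+2 * 2 * (t%:R * #|embeddings (complete_graph s.+2) G|%:R) :> R by ring.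
  apply: (@le_trans _ _ ((8 / b) ^+ s.+2 * 2 * (#|U|%:R * (a ^_ s.+2)%:R))); last first.
    by rewrite ler_wpM2l // mulr_ge0 ?exprn_ge0 ?divr_ge0 ?(ltW b0).
  have -> : (8 / b) ^+ s.+2 * 2 * (#|U|%:R * (a ^_ s.+2)%:R) =
     (8 / b) ^+ s.+2 * (a ^_ s.+2)%:R * (2 * #|U|%:R) :> R by ring.
  apply: ler_pM; rewrite ?exprn_ge0 ?(ltW z0) // ?(le_trans ler01) //.
  have -> : 8 / b = 4 / b * 2 :> R by ring.
  rewrite exprMn -mulrA; apply: (@le_trans _ _ ((4 / b) ^+ s.+2 * (a ^ s.+2)%:R)).
    rewrite natrX -exprMn lerXn2r ?nnegrE ?(ltW z0) ?mulr_ge0 ?invr_ge0 ?(ltW b0) //.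
    by rewrite mulrAC ler_pdivlMr // mulrC.
  rewrite ler_wpM2l ?exprn_ge0 ?divr_ge0 // ?(ltW b0) //.
  by rewrite -natrX -natrM ler_nat expn_le_ffact.
move: bi; rewrite -(ler_nat R) => /le_trans; apply.
have -> : (#|U| * a ^ 2 * (2 * t * a) ^ t)%:R =
    (2 * t)%:R ^+ t * (a%:R ^+ t.+2 * #|U|%:R) :> R.
  have -> : a%:R ^+ t.+2 = a%:R ^+ 2 * a%:R ^+ t :> R by rewrite -exprD.
  by rewrite 2!natrM !natrX [(2 * t * a)%N%:R]natrM exprMn; ring.
have zt : z ^+ t * N3 = z ^+ t.+2 * u.
  by rewrite /u -addn2 exprD; field; rewrite gt_eqF.
have -> : b ^+ t.+2 * (2 * t)%:R ^+ t * (z ^+ t * N3) =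
    (2 * t)%:R ^+ t * ((b * z) ^+ t.+2 * u) by rewrite zt exprMn; ring.
rewrite ler_wpM2l ?exprn_ge0 //; apply: ler_pM; rewrite ?exprn_ge0 //.
have h : 0 <= b * z by rewrite mulr_ge0 // ltW.
by rewrite lerXn2r ?nnegrE //; lra.
Qed.

Lemma few_paths_construction (b : R) : 0 < b -> exists c C : R, [/\ 0 < c, 0 < C &
  forall (n : nat) (k : R), (16 * t.+1)%:R ^+ t <= k ->
    (exists (B : sgraph) (U V : {set B}), few_paths_bigraph s.+2 t n k b U V) ->
    exists G : sgraph, [/\ #|G| = n,
      c * (k * n%:R `^ (3 / 2)) <= (ncopies (complete_graph s.+2) G)%:R &
      (ncopies (complete_bipartite 2 t) G)%:R
        <= C * Num.min (bound1 s.+2 t n k) (bound2 s.+2 t n k)]].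
Proof.
move=> b0; have [c2 [C2 [c20 C20 sparse]]] := @sparse_construction R t s st.
have /andP[_ rt] := st; have t2 : (2 <= t)%N by apply: leq_ltn_trans rt.
have [p sp p_pr] := prime_above s.+2.
pose F := complete_graph s.+2; pose f : R := (#|F| ^ #|F|)%:R.
have f0 : 0 < f by rewrite ltr0n expn_gt0 card_ord.
pose n1 := (s.+2 * p ^ 2)%N; pose z1 : R := (4 * s.+2)%:R / b.
have z10 : 0 < z1 by rewrite divr_gt0.
have p0 := prime_gt0 p_pr.
have n10 : (0 < n1)%N by rewrite muln_gt0 expn_gt0 p0.
pose w : R := (p ^ 2 * n1 ^ 2)%:R.
have w0 : 0 < w by rewrite ltr0n muln_gt0 !expn_gt0 p0 n10.
(* [c1], [c2], [c3] belong to the blocks, the random graph and the algebraic graph; [C3] bounds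
   [bound2] when [k <= z1 ^+ s] and [n < n1]. *)
pose c1 : R := (2 * t%:R * (8 / b) ^+ s.+2 * f)^-1.
pose c3 : R := (z1 ^+ s * (w * f))^-1.
pose e := (2 * ((3 * t - 2) * s + 2 * t))%N.
pose C3 : R := 1 + z1 ^+ s ^+ (2 * t ^ 2) * n1%:R ^+ e.
pose C1 : R := (b ^+ t.+2 * (2 * t)%:R ^+ t).
have tR : 0 < t%:R :> R by rewrite ltr0n.
have b8 : 0 < 8 / b by rewrite divr_gt0.
have c10 : 0 < c1 by rewrite invr_gt0 mulr_gt0 // mulr_gt0 ?exprn_gt0 // mulr_gt0.
have c30 : 0 < c3 by rewrite invr_gt0 !mulr_gt0 ?exprn_gt0.
have C31 : 1 <= C3 by rewrite lerDl mulr_ge0 ?exprn_ge0 ?(ltW z10).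
have C30 : 0 < C3 by apply: lt_le_trans C31.
have C10 : 0 < C1 by rewrite mulr_gt0 ?exprn_gt0 // ltr0n muln_gt0 t0.
have CC : 0 < C1 + C2 * C3 by rewrite addr_gt0 // mulr_gt0.
exists (Num.min c1 (Num.min c2 c3)), (C1 + C2 * C3).
split=> [||n k Ak [B [U [V few]]]]; [by rewrite !lt_min c10 c20|by []|].
have k1 : 1 <= k by apply: le_trans Ak; rewrite exprn_ege1 // ler1n.
have [x [y [z [[x1 y0 z1' y1] [kx kz ny n3] e1 e2]]]] := @bound_monomials R t s n k t0 s0 k1.
have z0 : 0 < z by apply: lt_le_trans z1'.
have x0 : 0 <= x by apply: le_trans x1.
have b10 : 0 <= bound1 s.+2 t n k by rewrite e1 mulr_ge0 ?exprn_ge0 // ltW.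
have b20 : 0 <= bound2 s.+2 t n k by rewrite e2 mulr_ge0 ?exprn_ge0.
have m0 : 0 <= Num.min (bound1 s.+2 t n k) (bound2 s.+2 t n k) by rewrite le_min b10.
set N3 := y ^+ (3 * den t s) in n3 e1.
have N30 : 0 <= N3 by rewrite exprn_ge0.
have kN0 : 0 <= k * N3 by rewrite mulr_ge0 // (le_trans ler01).
have d0 : (0 < den t s)%N by rewrite addn_gt0 t0 orbT.
(* Part (2) suffices whenever [bound2] is the minimum up to a constant. *)
have by_sparse : k * N3 <= n%:R ^+ s.+2 -> bound2 s.+2 t n k <= C3 * bound1 s.+2 t n k ->
    exists G : sgraph, [/\ #|G| = n,
      Num.min c1 (Num.min c2 c3) * (k * N3) <= (ncopies (complete_graph s.+2) G)%:R &
      (ncopies (complete_bipartite 2 t) G)%:R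
        <= (C1 + C2 * C3) * Num.min (bound1 s.+2 t n k) (bound2 s.+2 t n k)].
  move=> kN b21; have [|G [Gn cl bi]] := sparse n k Ak; first by rewrite n3.
  exists G; split=> //.
    rewrite n3 in cl; apply: le_trans cl; rewrite ler_wpM2r //.
    by rewrite !ge_min lexx orbT.
  apply: (le_trans bi); rewrite mulrDl -[leLHS]add0r; apply: lerD.
    by rewrite mulr_ge0 // ltW.
  rewrite -mulrA ler_wpM2l // ?(ltW C20) // minr_pMr ?(ltW C30) // le_min b21 /=.
  by rewrite ler_peMl.
rewrite n3; have [n0|n0] := posnP n.
  have yz : y = 0.
    by move/eqP: ny; rewrite n0 eq_sym expf_eq0 => /andP[_ /eqP].
  apply: by_sparse; first by rewrite /N3 yz expr0n /= muln_eq0 (gtn_eqF d0) /= mulr0 exprn_ge0.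
  have -> : bound2 s.+2 t n k = 0.
    rewrite e2 yz expr0n (_ : (_ == 0)%N = false) ?mulr0 //.
    by apply/negbTE; rewrite -lt0n muln_gt0 addn_gt0 [(0 < 2 * t)%N]muln_gt0 t0 orbT.
  by rewrite mulr_ge0 // ltW.
have {}y1 := y1 n0; have y_gt0 : 0 < y by apply: lt_le_trans y1.
have N3_gt0 : 0 < N3 by rewrite exprn_gt0.
have [UV Uc _ eB _] := few.
have rs : s.+2%:R - 2 = s%:R :> R by rewrite -addn2 natrD addrK.
have Uz : #|U| = Num.truncn (z ^- 2 * N3).
  by rewrite Uc rs n3 {1}kz (@powR_neg_root R z s 2) // ltW.
have Ez : b * (z^-1 * N3) <= #|edges B|%:R.
  by rewrite -n3 -[z^-1](@powR_neg_root R z s 1) ?(ltW z0) // -kz -rs.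
(* [B] has edges, and each meets [U]. Positivity of the truncated size gives [z ^+ 2 <= N3], from
   which [kN] follows. *)
have U0 : (0 < #|U|)%N.
  rewrite lt0n; apply/eqP => /eqP; rewrite cards_eq0 => /eqP Ue.
  have := edges_le_degrees UV; rewrite Ue big_set0 leqn0 => /eqP E0.
  by move: Ez; rewrite E0 leNgt !mulr_gt0 // invr_gt0.
have u1 : 1 <= z ^- 2 * N3.
  by move: U0; rewrite Uz truncn_gt0.
have kN : k * N3 <= n%:R ^+ s.+2.
  have zN : z ^+ 2 <= N3 by move: u1; rewrite mulrC ler_pdivlMr ?exprn_gt0 // mul1r.
  have zy : z <= y ^+ (2 * den t s).
    rewrite -(@ler_pXn2r _ 2) ?nnegrE ?exprn_ge0 // ?(ltW z0) //; apply: (le_trans zN).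
    by rewrite -exprM ler_weXn2l //; clear; lia.
  rewrite kz ny; apply: (@le_trans _ _ ((y ^+ (2 * den t s)) ^+ s * N3)).
    by rewrite ler_wpM2r // lerXn2r ?nnegrE ?exprn_ge0 // ltW.
  by rewrite -!exprM -exprD ler_weXn2l //; clear; nia.
have [bz|bz] := lerP (4 * s.+2)%:R (b * z).
  have [b21|] := boolP (bound2 s.+2 t n k <= bound1 s.+2 t n k).
    by apply: by_sparse => //; apply: (le_trans b21); rewrite ler_peMl.
  rewrite -ltNge => /ltW/min_idPl ->.
  have [G [Gn cl bi]] := few_paths_dense_blocks b0 z0 N30 bz few u1 Uz Ez.
  exists G; split=> //.
    apply: (@le_trans _ _ (c1 * (k * N3))).
      by rewrite ler_wpM2r // ge_min lexx.
    rewrite ler_pdivrMl; last by rewrite -invr_gt0.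
    rewrite kz; apply: (le_trans cl); rewrite -[leRHS]mulrA ler_wpM2l //.
      by rewrite mulr_ge0 ?exprn_ge0 ?(ltW b8) // mulr_ge0.
    exact: embeddings_card_le.
  apply: (@le_trans _ _ (#|embeddings (complete_bipartite 2 t) G|%:R)).
    by rewrite ler_nat ncopies_le_embeddings.
  apply: (le_trans bi); rewrite -e1 -/C1 mulrDl.
  by rewrite lerDl mulr_ge0 // mulr_ge0 ?(ltW C20) ?(ltW C30).
(* Blocks would be too small, but now [k] is bounded: the algebraic graph serves for [n >= n1]; for
   smaller [n], [bound2] is bounded and [bound1 >= 1]. *)
have zz1 : z <= z1 by rewrite /z1 ler_pdivlMr // mulrC ltW.
have kz1 : k <= z1 ^+ s by rewrite kz lerXn2r ?nnegrE // ltW.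
have [n1n|nn1] := leqP n1 n.
  have [G [Gn cl bi]] := @many_cliques_no_biclique R p s.+2 t n p_pr isT (ltnW sp)
    t2 rt n1n.
  exists G; split=> //.
    apply: (@le_trans _ _ (c3 * (k * N3))).
      by rewrite ler_wpM2r // !ge_min lexx !orbT.
    rewrite ler_pdivrMl; last by rewrite -invr_gt0.
    rewrite -[leRHS]mulrA; apply: ler_pM; rewrite // ?(le_trans ler01) //.
    rewrite -n3; apply: (le_trans cl); rewrite -[leRHS]mulrA ler_wpM2l //.
    exact: embeddings_card_le.
  have := ncopies_le_embeddings (complete_bipartite 2 t) G.
  by rewrite bi leqn0 => /eqP->; rewrite mulr_ge0 ?(ltW CC).
apply: by_sparse => //; apply: (@le_trans _ _ C3); last first.
  by rewrite ler_peMr ?(ltW C30) // e1 mulr_ege1 ?exprn_ege1.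
rewrite e2 /C3 -[leLHS]add0r lerD //; apply: ler_pM; rewrite ?exprn_ge0 //.
  rewrite lerXn2r ?nnegrE ?exprn_ge0 ?(ltW z10) //; apply: le_trans kz1.
  by rewrite kx ler_eXnr.
rewrite lerXn2r ?nnegrE //; apply: (@le_trans _ _ n%:R); last by rewrite ler_nat ltnW.
by rewrite ny ler_eXnr // muln_gt0.
Qed.

End FewPaths.

Unset Implicit Arguments.

Theorem theorem1p7 (R : realType) (t : nat) (ht : (2 <= t)%N) :
  exists k0 : R, forall r : nat, (2 < r)%N -> (r < 2 + t)%N ->
  [/\ (exists2 c : R, 0 < c &
        forall (n : nat) (k : R) (G : sgraph), k0 <= k -> #|G| = n ->
          (ncopies (complete_graph r) G)%:R = k * n%:R `^ (3 / 2) ->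
          c * Num.min (bound1 r t n k) (bound2 r t n k)
            <= (ncopies (complete_bipartite 2 t) G)%:R),
      (exists c C : R, [/\ 0 < c, 0 < C &
        forall (n : nat) (k : R), k0 <= k ->
          k * n%:R `^ (3 / 2) <= n%:R ^+ r ->
          exists G : sgraph, [/\ #|G| = n,
            c * (k * n%:R `^ (3 / 2)) <= (ncopies (complete_graph r) G)%:R &
            (ncopies (complete_bipartite 2 t) G)%:R <= C * bound2 r t n k]]) &
      (forall b : R, 0 < b -> exists c C : R, [/\ 0 < c, 0 < C &
        forall (n : nat) (k : R), k0 <= k ->
          (exists (B : sgraph) (U V : {set B}),
             few_paths_bigraph r t n k b U V) ->
          exists G : sgraph, [/\ #|G| = n,
            c * (k * n%:R `^ (3 / 2)) <= (ncopies (complete_graph r) G)%:R &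
            (ncopies (complete_bipartite 2 t) G)%:R
              <= C * Num.min (bound1 r t n k) (bound2 r t n k)]])].
Proof.
(* Free of [r], this dominates both thresholds, [(16 * t ^ 2) ^ t] and [(16 * t.+1) ^ t]. *)
exists ((16 * t.+1 ^ 2)%:R ^+ t) => -[//|[//|s]] s0 st.
have {}st : (0 < s < t)%N by move: s0 st; rewrite !ltnS => -> /=.
have le_k (A : nat) (k : R) : (A <= t.+1 ^ 2)%N -> (16 * t.+1 ^ 2)%:R ^+ t <= k ->
    (16 * A)%:R ^+ t <= k.
  by move=> At; apply: le_trans; rewrite lerXn2r ?nnegrE // ler_nat leq_mul2l.
have t1 : (t.+1 <= t.+1 ^ 2)%N by rewrite -mulnn leq_pmulr.
have t2 : (t ^ 2 <= t.+1 ^ 2)%N by rewrite leq_exp2r.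
split.
- have [c c0 h] := @supersaturation R t s st; exists c => // n k G /(le_k _ _ t2).
  exact: h.
- have [c [C [c0 C0 h]]] := @sparse_construction R t s st; exists c, C; split=> //.
  by move=> n k /(le_k _ _ t1); apply: h.
- move=> b b0; have [c [C [c0 C0 h]]] := few_paths_construction st b0.
  by exists c, C; split=> // n k /(le_k _ _ t1); apply: h.
Qed.
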